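(* Let $X(z)=\operatorname{diag}(z_1,\dots,z_q)$ and define $$\mathcal P(z_1,\dots,z_q):=\sum_{I\subseteq N}\Psi_I\prod_{i\in I}z_i ,$$ where $N=(x_1,\dots,x_q)$ is identified with $\{1,\dots,q\}$ through its fixed order. Then $$\mathcal P(z)=\Phi_{\mathrm{valid}}\det\bigl(I_q+X(z)L\bigr),$$ and $\mathcal P$ is multiaffine, coefficientwise nonnegative and real stable.
   Context: Network. $G=(V,E)$ is a finite connected simple undirected graph; each edge $e$ has a conductance $c_e\in\mathbb R_{>0}$. The weighted Laplacian $L_c$ is the $V\times V$ matrix with $(L_c)_{uu}=\sum_{e\ni u}c_e$, $(L_c)_{uv}=-c_{uv}$ if $uv\in E$, and $0$ otherwise. A spanning forest $F$ of $G$ is an acyclic subgraph with vertex set $V$ (isolated vertices allowed); $w(F)=\prod_{e\in F}c_e$; $\mathcal F_m$ is the set of spanning forests with exactly $m$ connected components. Superports. The boundary $M\subseteq V$ is nonempty and partitioned into nonempty superports $M=A_1\sqcup\cdots\sqcup A_p$. Choose a root $r_a\in A_a$ for each $a$; $R=\{r_1,\dots,r_p\}$, $N=M\setminus R$, $q=|N|$, $N=(x_1,\dots,x_q)$ in a fixed order; $r(x)$ is the root of the superport containing $x$. Superport response. Given $y\in\mathbb R^N$, consider voltages $U\in\mathbb R^V$ with $U_x-U_{r(x)}=y_x$ for all $x\in N$ whose incoming-current vector $\iota=L_cU$ satisfies $\iota_v=0$ for $v\notin M$ and $\sum_{v\in A_a}\iota_v=0$ for every $a$. Put $j_x=\iota_x$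 for $x\in N$ (the independent incoming currents). The linear map $y\mapsto j$ is the superport response and $L$ is its $q\times q$ matrix: $j=Ly$. Valid forests. A spanning forest is valid if identifying all boundary vertices within each superport (one vertex per superport) turns it into a spanning tree of the quotient network (loops and parallel edges count as cycles). $\Phi_{\mathrm{valid}}=\sum_{F\text{ valid}}w(F)$. Quotient port graph and principal numerators. For a spanning forest $F$, the quotient port multigraph $H_F$ has the connected components of $F$ as vertices, and each $x\in N$ gives a directed edge from the component containing $r(x)$ to the component containing $x$ (a loop if these coincide). For $I\subseteq N$ with $|I|=k$, $\Psi_I$ is the sum of $w(F)$ over those $F\in\mathcal F_{q-k+1}$ for which the edge set $N\setminus I$ is a spanning tree of $H_F$; $\Psi_\varnothing:=\Phi_{\mathrm{valid}}$. A real polynomial is real stable if it has no zero $z\in\mathbb C^q$ with $\operatorname{Im}z_i>0$ for all $i$; it is multiaffine if it has degree at most one in each variable. *)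

(* Defs.v *)
From HB Require Import structures.
From mathcomp Require Import all_boot all_order all_algebra.
From mathcomp Require Import boolp reals complex mpoly ring lra.
Set Implicit Arguments.
Unset Strict Implicit.
Unset Printing Implicit Defensive.
Import Order.TTheory GRing.Theory Num.Theory.
Local Open Scope ring_scope.

(* A multigraph is presented by a set [W] of vertices and an incidence relation
   [joins e u v], "the edge e has endpoints u and v" (in either order).  Loops
   and parallel edges are allowed. *)
Section Multigraph.
Variables (T Ed : finType) (joins : Ed -> rel T).

Definition adj (S : {set Ed}) : rel T :=
  fun u v => [exists e in S, joins e u v].

Definition mg_connected (W : {set T}) (S : {set Ed}) : Prop :=
  {in W &, forall u v, connect (adj S) u v}.

(* The sequence (v_1, e_1), ..., (v_k, e_k) stands for the closed walk
   v_1 -e_1- v_2 -e_2- ... v_k -e_k- v_1; a loop is a cycle with k = 1, and two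
   parallel edges form a cycle with k = 2. *)
Definition mg_cycle (p : seq (T * Ed)) : Prop :=
  [/\ p != [::], cycle (fun d d' => joins d.2 d.1 d'.1) p,
      uniq (map fst p) & uniq (map snd p)].

Definition mg_acyclic (S : {set Ed}) : Prop :=
  ~ exists2 p, mg_cycle p & {subset map snd p <= S}.

Definition mg_spanning_tree (W : {set T}) (S : {set Ed}) : Prop :=
  mg_connected W S /\ mg_acyclic S.

End Multigraph.

(* The edges of a simple graph on V are two-element subsets of V. *)
Section Network.
Variables (R : realType) (V : finType).
Variables (E : {set {set V}}) (c : {set V} -> R).

Definition simple_graph : Prop := forall e, e \in E -> #|e| = 2%N.

Definition link (e : {set V}) : rel V := fun u v => e == [set u; v].

Definition connected_graph : Prop := mg_connected link [set: V] E.

Definition laplacian (u v : V) : R :=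
  if u == v then \sum_(e in E | u \in e) c e
  else if [set u; v] \in E then - c [set u; v] else 0.

Definition incoming (U : V -> R) (v : V) : R := \sum_u laplacian v u * U u.

Definition spanning_forest (F : {set {set V}}) : Prop :=
  F \subset E /\ mg_acyclic link F.

Definition weight (F : {set {set V}}) : R := \prod_(e in F) c e.

Definition component (F : {set {set V}}) (v : V) : {set V} :=
  [set u | connect (adj link F) v u].

Definition components (F : {set {set V}}) : {set {set V}} :=
  [set component F v | v : V].

(* [P] is the set of superports, [r A] the root of the superport [A]. *)
Variables (M : {set V}) (P : {set {set V}}) (r : {set V} -> V).

Definition root_of (v : V) : V := r (pblock P v).

Definition nonroots : {set V} := M :\: [set r A | A in P].

(* Identifying the vertices within each superport: a vertex of the quotient is
   either a superport or an interior vertex, the latter as a singleton. *)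
Definition qvertex (v : V) : {set V} := if v \in M then pblock P v else [set v].

Definition qlink (e : {set V}) : rel {set V} := fun a b =>
  [exists u, exists v, [&& link e u v, qvertex u == a & qvertex v == b]].

Definition valid (F : {set {set V}}) : Prop :=
  spanning_forest F /\ mg_spanning_tree qlink [set qvertex v | v : V] F.

Definition Phi_valid : R := \sum_(F : {set {set V}} | `[< valid F >]) weight F.

(* Incidence in the quotient port multigraph H_F, whose vertices are the
   components of F and whose edges are labelled by the nonroots.  Orientations
   play no role for spanning trees. *)
Definition hlink (F : {set {set V}}) (x : V) : rel {set V} := fun a b =>
  ((component F (root_of x) == a) && (component F x == b)) ||
  ((component F (root_of x) == b) && (component F x == a)).

Definition psi_forest (I : {set V}) (F : {set {set V}}) : Prop :=
  [/\ spanning_forest F,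
      #|components F| = (#|nonroots| - #|I| + 1)%N &
      mg_spanning_tree (hlink F) (components F) (nonroots :\: I)].

Definition Psi (I : {set V}) : R :=
  if I == set0 then Phi_valid
  else \sum_(F : {set {set V}} | `[< psi_forest I F >]) weight F.

(* [x] enumerates the nonroots. *)
Variables (q : nat) (x : 'I_q -> V).

Definition admissible (y : 'cV[R]_q) (U : V -> R) : Prop :=
  [/\ forall i, U (x i) - U (root_of (x i)) = y i 0,
      forall v, v \notin M -> incoming U v = 0 &
      forall A, A \in P -> \sum_(v in A) incoming U v = 0].

(* L is the matrix of the map y |-> j; this determines L, and such an L exists
   by [superport_response_exists] below. *)
Definition is_superport_response (L : 'M[R]_q) : Prop :=
  forall y j : 'cV[R]_q,
    (exists2 U, admissible y U & forall i, j i 0 = incoming U (x i))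
    <-> j = L *m y.

Definition port_polynomial : {mpoly R[q]} :=
  \sum_(I : {set 'I_q}) Psi [set x i | i in I] *: \prod_(i in I) 'X_i.

End Network.

Section Polynomials.
Variables (R : realType) (q : nat).

Definition multiaffine (p : {mpoly R[q]}) : Prop :=
  forall m, m \in msupp p -> forall i, (m i <= 1)%N.

Definition coef_nonneg (p : {mpoly R[q]}) : Prop := forall m, 0 <= p@_m.

Definition real_stable (p : {mpoly R[q]}) : Prop :=
  forall z : 'I_q -> R[i], (forall i, 0 < complex.Im (z i)) ->
    (map_mpoly (real_complex R) p).@[z] != 0.

End Polynomials.

Section ResponseExists.
Variables (R : realType) (V : finType).
Variables (E : {set {set V}}) (c : {set V} -> R).
Variables (M : {set V}) (P : {set {set V}}) (r : {set V} -> V).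
Variables (q : nat) (x : 'I_q -> V).
Hypothesis (E2 : simple_graph E) (Econn : connected_graph E).
Hypothesis (c_gt0 : forall e, e \in E -> 0 < c e).
Hypothesis (M0 : M != set0) (PM : partition P M).
Hypothesis (rP : forall A, A \in P -> r A \in A).
Hypothesis (x_inj : injective x).
Hypothesis (xN : [set x i | i : 'I_q] = nonroots M P r).

Let iota := incoming E c.

Lemma incomingE U v :
  iota U v = \sum_(u | [set v; u] \in E) c [set v; u] * (U v - U u).
Proof.
have nvv : [set v; v] \notin E.
  by apply/negP => /E2; rewrite setUid cards1.
have D : laplacian E c v v = \sum_(u | [set v; u] \in E) c [set v; u].
  rewrite /laplacian eqxx.
  pose A := [set u | [set v; u] \in E].
  have inj : {in A &, injective (fun u => [set v; u])}.
    move=> u w; rewrite !inE => Eu Ew uw.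
    have : u \in [set v; w] by rewrite -uw !inE eqxx orbT.
    rewrite !inE => /orP[/eqP uv|/eqP//].
    by move: Eu; rewrite uv (negPf nvv).
  transitivity (\sum_(e in [set [set v; u] | u in A]) c e).
    apply: eq_bigl => e; apply/andP/imsetP => [[eE ve]|[u]]; last first.
      by rewrite inE => uE ->; split=> //; rewrite !inE eqxx.
    have /eqP/cards2P[a [b [ab eab]]] := E2 eE.
    move: ve eE; rewrite eab !inE => /orP[]/eqP va eE.
      by exists b; rewrite ?inE va.
    by exists a; rewrite ?inE va setUC.
  by rewrite big_imset //=; apply: eq_bigl => u; rewrite inE.
rewrite /iota /incoming (bigD1 v) //= D mulr_suml.
transitivity (\sum_(u | [set v; u] \in E) c [set v; u] * U v
   - \sum_(u | [set v; u] \in E) c [set v; u] * U u); last first.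
  by rewrite -sumrB; apply: eq_bigr => u _; rewrite mulrBr.
congr (_ + _); rewrite -sumrN [RHS]big_mkcond [RHS](bigD1 v) //= (negPf nvv).
rewrite add0r; apply: eq_bigr => u uv; rewrite /laplacian eq_sym (negPf uv).
by case: ifP => _; rewrite ?mul0r // mulNr.
Qed.

Lemma incoming_const U : (forall u v, U u = U v) -> forall v, iota U v = 0.
Proof.
by move=> h v; rewrite incomingE big1 // => u _; rewrite (h v u) subrr mulr0.
Qed.

Lemma sum_incoming U : \sum_v iota U v = 0.
Proof.
set s := \sum_v _; suff : s = - s by lra.
rewrite {1}/s (eq_bigr _ (fun v _ => incomingE U v)).
rewrite (exchange_big_dep xpredT) //= /s -sumrN; apply: eq_bigr => v _.
rewrite incomingE -sumrN; apply: eq_big => [u|u _]; rewrite setUC //.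
by rewrite -mulrN opprB.
Qed.

Lemma energy0 U : \sum_v U v * iota U v = 0 -> forall u v, U u = U v.
Proof.
set s := \sum_v _ => s0.
pose g v u := c [set v; u] * (U v - U u) ^+ 2.
have s1 : s = \sum_v \sum_(u | [set v; u] \in E)
    U v * (c [set v; u] * (U v - U u)).
  by apply: eq_bigr => v _; rewrite incomingE mulr_sumr.
have s2 : s = \sum_v \sum_(u | [set v; u] \in E)
    U u * (c [set v; u] * (U u - U v)).
  rewrite s1 (exchange_big_dep xpredT) //=; apply: eq_bigr => v _.
  by apply: eq_big => [u|u _]; rewrite setUC.
have : \sum_v \sum_(u | [set v; u] \in E) g v u = 0.
  transitivity (s + s); last by rewrite s0 addr0.
  rewrite [X in X + _]s1 [X in _ + X]s2 -big_split /=.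
  apply: eq_bigr => v _; rewrite -big_split /=; apply: eq_bigr => u _.
  by rewrite /g; ring.
have g0 v u : [set v; u] \in E -> 0 <= g v u.
  by move=> h; rewrite mulr_ge0 ?sqr_ge0 // ltW // c_gt0.
move/eqP; rewrite psumr_eq0 => [/allP h|v _]; last first.
  by apply: sumr_ge0 => u; exact: g0.
have adjU u v : adj (@link V) E u v -> U u = U v.
  case/exists_inP => e eE /eqP euv; rewrite euv in eE.
  have /= := h u (mem_index_enum u); rewrite psumr_eq0 => [/allP k|w]; last first.
    exact: g0.
  have /= := k v (mem_index_enum v); rewrite eE mulf_eq0 sqrf_eq0 subr_eq0.
  by rewrite gt_eqF ?c_gt0 //= => /eqP.
move=> u v; have /connectP[p pth ->] := Econn (in_setT u) (in_setT v).
elim: p u pth => //= w p IH u /andP[/adjU -> /IH]; exact.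
Qed.

Lemma root_of_r A : A \in P -> pblock P (r A) = A.
Proof.
by case/and3P: PM => _ tP _ AP; apply: def_pblock => //; exact: rP.
Qed.

Lemma port_unique U : admissible E c M P r x 0 U -> forall u v, U u = U v.
Proof.
case=> Ux UM UP; apply: energy0.
case/and3P: (PM) => /eqP cP tP _.
rewrite (bigID (mem M)) /= [X in _ + X]big1 => [|v vM]; last first.
  by rewrite /iota UM ?mulr0.
rewrite addr0 -cP big_trivIset //= big1 // => A AP.
transitivity (U (r A) * \sum_(v in A) iota U v); last by rewrite UP ?mulr0.
rewrite [RHS]mulr_sumr; apply: eq_bigr => v vA.
congr (_ * _); have pv := def_pblock tP AP vA.
have vM : v \in M by rewrite -cP; apply/bigcupP; exists A.
case: (boolP (v \in [set r A | A in P])) => [/imsetP[B BP vB]|vN].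
  by rewrite -pv vB root_of_r.
have : v \in nonroots M P r by rewrite inE vN.
rewrite -xN => /imsetP[i _ vi]; move/eqP: (Ux i).
by rewrite mxE subr_eq0 /root_of -vi pv => /eqP.
Qed.

Lemma incomingZD a U W v :
  iota (fun u => a * U u + W u) v = a * iota U v + iota W v.
Proof.
rewrite /iota /incoming mulr_sumr -big_split /=; apply: eq_bigr => u _; ring.
Qed.

(* The equation at one root r0 is redundant and is replaced by U r0 = 0. *)
Definition response_eqns (r0 : V) (U : {ffun V -> R^o}) : {ffun V -> R^o} :=
  [ffun v => if v == r0 then U r0
             else if v \in nonroots M P r then U v - U (root_of P r v)
             else if v \in M then \sum_(w in pblock P v) iota U w
             else iota U v].

Lemma response_eqns_linear r0 : linear (response_eqns r0).
Proof.
move=> a U W; apply/ffunP => v; rewrite !ffunE.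
have h w : iota (a *: U + W) w = a * iota U w + iota W w.
  rewrite -incomingZD; apply: eq_bigr => u _; congr (_ * _).
  by rewrite !ffunE.
case: ifP => _ //; case: ifP => _; first by rewrite /GRing.scale /=; ring.
case: ifP => _ //; rewrite (eq_bigr _ (fun w _ => h w)) big_split /=.
by rewrite -mulr_sumr.
Qed.
HB.instance Definition _ r0 :=
  GRing.isLinear.Build R {ffun V -> R^o} {ffun V -> R^o} _ (response_eqns r0)
    (response_eqns_linear r0).

Lemma port_exists (y : 'cV[R]_q) : exists U, admissible E c M P r x y U.
Proof.
case/and3P: (PM) => /eqP cP tP _.
have /set0Pn[v0 v0M] := M0.
have A0P : pblock P v0 \in P by rewrite pblock_mem // cP.
set A0 := pblock P v0 in A0P.
have rN A : A \in P -> r A \notin nonroots M P r.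
  move=> AP; rewrite inE negb_and negbK; apply/orP; left.
  by apply/imsetP; exists A.
have rM A : A \in P -> r A \in M.
  by move=> AP; rewrite -cP; apply/bigcupP; exists A => //; exact: rP.
have adm (z : 'cV[R]_q) (U : {ffun V -> R^o}) :
    (forall i, response_eqns (r A0) U (x i) = z i 0) ->
    (forall v, v \notin nonroots M P r -> response_eqns (r A0) U v = 0) ->
    admissible E c M P r x z U.
  move=> Uz U0.
  have UM v : v \notin M -> iota U v = 0.
    move=> vM; have vN : v \notin nonroots M P r by rewrite inE (negPf vM) andbF.
    have := U0 v vN; rewrite ffunE (negPf vN) (negPf vM).
    by case: eqP => // vr; move: vM; rewrite vr rM.
  have UP A : A \in P -> A != A0 -> \sum_(v in A) iota U v = 0.
    move=> AP AA0; have := U0 _ (rN _ AP).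
    rewrite ffunE (negPf (rN _ AP)) rM // root_of_r //.
    case: eqP => // rr; case/eqP: AA0.
    by rewrite -(root_of_r AP) rr root_of_r.
  split=> //.
    move=> i; have := Uz i; rewrite ffunE.
    have xiN : x i \in nonroots M P r by rewrite -xN imset_f.
    rewrite xiN; case: eqP => // xr; move: xiN; rewrite xr.
    by rewrite (negPf (rN _ A0P)).
  move=> A AP; case: (eqVneq A A0) => [->|]; last exact: UP.
  have := sum_incoming U; rewrite (bigID (mem M)) /=.
  rewrite [X in _ + X]big1 ?addr0 => [|v]; last exact: UM.
  rewrite -{1}cP big_trivIset //= (bigD1 A0) //= [X in _ + X]big1 ?addr0 //.
  by move=> B /andP[]; exact: UP.
pose f := linfun (response_eqns (r A0)).
have kf : lker f == 0%VS.
  apply/lker0P => U W; rewrite !lfunE /= => /eqP; rewrite -subr_eq0 -linearB /=.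
  move=> /eqP e0; apply/eqP; rewrite -subr_eq0; apply/eqP/ffunP => v.
  have e1 u : response_eqns (r A0) (U - W) u = 0 by rewrite e0 ffunE.
  have h : admissible E c M P r x 0 (U - W).
    by apply: adm => // i; rewrite e1 mxE.
  rewrite (port_unique h v (r A0)); have := e1 (r A0).
  by rewrite ffunE eqxx => ->; rewrite ffunE.
pose t : {ffun V -> R^o} := [ffun v => \sum_(i | x i == v) y i 0].
have : t \in limg f by rewrite (lker0_limgf kf) memvf.
case/memv_imgP => U _; rewrite lfunE /= => tU; exists U; apply: adm => [i|v vN].
  rewrite -tU ffunE (bigD1 i) //= big1 ?addr0 // => j /andP[/eqP/x_inj ->].
  by rewrite eqxx.
rewrite -tU ffunE big_pred0 // => i; apply/negP => /eqP xi.
by move: vN; rewrite -xi -xN imset_f.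
Qed.

Lemma superport_response_exists :
  exists L : 'M[R]_q, is_superport_response E c M P r x L.
Proof.
have [U adU] := choice (fun i : 'I_q => port_exists (delta_mx i 0)).
exists (\matrix_(i, j) iota (U j) (x i)) => y j.
pose W v := \sum_k y k 0 * U k v.
have iW v : iota W v = \sum_k y k 0 * iota (U k) v.
  transitivity (\sum_u \sum_k laplacian E c v u * (y k 0 * U k u)).
    by apply: eq_bigr => u _; rewrite /W mulr_sumr.
  rewrite exchange_big /=; apply: eq_bigr => k _.
  by rewrite /iota /incoming mulr_sumr; apply: eq_bigr => u _; rewrite mulrCA.
have adW : admissible E c M P r x y W.
  split.
  - move=> i; rewrite /W -sumrB (bigD1 i) //= big1 ?addr0 => [|k ki].
      by case: (adU i) => /(_ i) h _ _; rewrite -mulrBr h mxE !eqxx mulr1.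
    case: (adU k) => /(_ i) h _ _.
    by rewrite -mulrBr h mxE eq_sym (negPf ki) mulr0.
  - move=> v vM; rewrite -/(iota W v) iW big1 // => k _.
    by case: (adU k) => _ /(_ v vM) h _; rewrite /iota h mulr0.
  - move=> A AP; rewrite -/iota (eq_bigr _ (fun v _ => iW v)) exchange_big /=.
    rewrite big1 // => k _; case: (adU k) => _ _ /(_ A AP) h.
    by rewrite -mulr_sumr /iota h mulr0.
have LW i : (\matrix_(i, j) iota (U j) (x i) *m y) i 0 = iota W (x i).
  by rewrite mxE iW; apply: eq_bigr => k _; rewrite mxE mulrC.
split=> [[Z adZ jZ]|->]; last by exists W.
apply/colP => i; rewrite LW jZ -/(iota Z _).
pose D v := -1 * W v + Z v.
have iD v : iota D v = -1 * iota W v + iota Z v by exact: incomingZD.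
suff D0 : iota D (x i) = 0 by have := iD (x i); rewrite D0; lra.
apply: incoming_const; apply: port_unique.
case: adW => W1 W2 W3; case: adZ => Z1 Z2 Z3; split.
- by move=> k; have := W1 k; have := Z1 k; rewrite mxE /D; lra.
- by move=> v vM; rewrite -/iota iD /iota W2 // Z2 // mulr0 addr0.
- move=> A AP; rewrite -/iota (eq_bigr _ (fun v _ => iD v)) big_split /=.
  by rewrite -mulr_sumr /iota W3 // Z3 // mulr0 addr0.
Qed.

End ResponseExists.

(* Main.v *)
(* Add to G one edge from r(x) to x, of conductance 1/z_x, for every nonroot x,
   and ground one vertex r0 by an edge of conductance 1.  By Cauchy-Binet the
   determinant of the resulting grounded Laplacian A + B^T Z^-1 B enumerates the
   spanning trees of the augmented graph; such a tree consists of a forest F of G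
   and of a set J of port edges, and it is a tree exactly when J is a spanning
   tree of H_F (for J = N: exactly when F is valid).  Multiplying by the product
   of the z_x therefore gives P(z).
   The port impedance G = B A^-1 B^T satisfies L G = 1, whence
   P(z) = det A det G det(1 + Z L); at z = 0 this reads Phi_valid = det A det G.
   Since A and G are symmetric, so is L.  If v + v Z L = 0 and u = v Z, then
   sum_i conj(u_i) v_i = - u L u^* is real, while its imaginary part is
   - sum_i Im(z_i) |v_i|^2; hence v = 0, which is real stability. *)
Require Import Defs.
From HB Require Import structures.
From mathcomp Require Import all_boot all_order fingroup perm all_algebra.
From mathcomp Require Import boolp reals complex mpoly.
From mathcomp Require Import ring.
Set Implicit Arguments.
Unset Strict Implicit.
Unset Printing Implicit Defensive.
Import Order.TTheory GRing.Theory Num.Theory.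
Local Open Scope ring_scope.

(** * Components and cycles of multigraphs *)

(** Induction along a path. The invariant is [Prop]-valued, so it may carry quantifiers and
    existential witnesses. *)
Lemma connect_closed (T : finType) (e : rel T) (Q : T -> Prop) u v :
  (forall a b, e a b -> Q a -> Q b) -> connect e u v -> Q u -> Q v.
Proof.
move=> cl /connectP[p pth ->]; elim: p u pth => //= w p IH u /andP[uw pw] Qu.
exact: IH pw (cl _ _ uw Qu).
Qed.

(** Contracting by [h] preserves reachability when each fibre is connected upstairs and each edge
    downstairs lifts to a connected pair. This serves both contractions: of forest components and of
    superports. *)
Lemma connect_quotient (T T' : finType) (e : rel T) (e' : rel T') (h : T -> T') :
  (forall u v, e u v -> connect e' (h u) (h v)) ->
  (forall u v, h u = h v -> connect e u v) ->
  (forall a b, e' a b -> exists u v, [/\ h u = a, h v = b & connect e u v]) ->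
  forall u v, connect e' (h u) (h v) = connect e u v.
Proof.
move=> e1 e2 e3 u v; apply/idP/idP => [c|].
  suff : forall w, h w = h v -> connect e u w by exact.
  apply: (connect_closed (Q := fun X => forall w, h w = X -> connect e u w) _ c).
    move=> _ _ /e3[a [b [<- <- ab]]] Qa w wb.
    exact: connect_trans (connect_trans (Qa a erefl) ab) (e2 _ _ (esym wb)).
  by move=> w /esym; exact: e2.
move=> c; apply: (connect_closed (Q := fun w => connect e' (h u) (h w)) _ c).
  by move=> a b /e1 ab ua; exact: connect_trans ua ab.
exact: connect0.
Qed.

Section CountingComponents.
Variables (T Ed : finType) (joins : Ed -> rel T) (W : {set T}).

(** A general [joins] may relate one edge to many pairs; this pins each edge to a single unordered
    pair of endpoints in [W], which also makes adjacency symmetric. *)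
Definition ends_in (S : {set Ed}) := forall e, e \in S ->
  exists a b, [/\ a \in W, b \in W &
    forall u v, joins e u v = ((u == a) && (v == b)) || ((u == b) && (v == a))].

Definition comps (S : {set Ed}) : {set {set T}} :=
  [set [set u | connect (adj joins S) v u] | v in W].

Lemma ends_in_sub (S S' : {set Ed}) : S' \subset S -> ends_in S -> ends_in S'.
Proof. by move=> /subsetP sS eS e /sS /eS. Qed.

Lemma adj_sub (S S' : {set Ed}) u v :
  S' \subset S -> adj joins S' u v -> adj joins S u v.
Proof.
move=> /subsetP sS /exists_inP[e eS' euv]; apply/exists_inP; exists e => //.
exact: sS.
Qed.

Lemma connect_adj_sub (S S' : {set Ed}) u v : S' \subset S ->
  connect (adj joins S') u v -> connect (adj joins S) u v.
Proof.
by move=> sS; apply: connect_sub => a b /(adj_sub sS) /connect1.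
Qed.

Lemma adj_sym S : ends_in S -> connect_sym (adj joins S).
Proof.
move=> eS; apply: sym_connect_sym => u v.
apply: eq_existsb => e; case: (boolP (e \in S)) => //= /eS[a [b [_ _ jE]]].
by rewrite !jE orbC; congr (_ || _); rewrite andbC.
Qed.

Lemma comp_eqP S u v : ends_in S ->
  ([set w | connect (adj joins S) u w] == [set w | connect (adj joins S) v w])
  = connect (adj joins S) u v.
Proof.
move=> eS; apply/eqP/idP => [/setP /(_ v)|uv]; first by rewrite !inE connect0.
by apply/setP => w; rewrite !inE; exact: (same_connect (adj_sym eS) uv).
Qed.

(** A walk need cross the new edge at most once: the three-way disjunction is invariant under one
    more step, whether that step uses [e] or an edge of [S]. *)
Lemma connect_addU1 (S : {set Ed}) e a b :
  ends_in S ->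
  (forall u v, joins e u v = ((u == a) && (v == b)) || ((u == b) && (v == a))) ->
  forall u v, connect (adj joins (e |: S)) u v =
    [|| connect (adj joins S) u v,
     connect (adj joins S) u a && connect (adj joins S) b v |
     connect (adj joins S) u b && connect (adj joins S) a v].
Proof.
move=> eS eab u v; set c := connect (adj joins S).
have cS s t : c s t -> connect (adj joins (e |: S)) s t.
  by apply: connect_adj_sub; exact: subsetUr.
have ab : connect (adj joins (e |: S)) a b.
  by apply/connect1/exists_inP; exists e; rewrite ?setU11 // eab !eqxx.
have ba : connect (adj joins (e |: S)) b a.
  by apply/connect1/exists_inP; exists e; rewrite ?setU11 // eab !eqxx orbT.
apply/idP/idP => [cuv|]; last first.
  case/or3P => [/cS //|/andP[/cS ua /cS bv]|/andP[/cS ub /cS av]].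
    exact: connect_trans (connect_trans ua ab) bv.
  exact: connect_trans (connect_trans ub ba) av.
apply: (connect_closed (Q := fun v => [|| c u v, c u a && c b v | c u b && c a v])
  _ cuv); last by rewrite /c connect0.
move=> s t /exists_inP[e']; rewrite in_setU1 => /orP[/eqP ->|e'S] st.
  have cC := adj_sym eS.
  rewrite eab in st; case/orP: st => /andP[/eqP -> /eqP ->].
    by case/or3P => [h|/andP[h _]|/andP[h _]]; rewrite h /c ?connect0 ?orbT.
  by case/or3P => [h|/andP[h _]|/andP[h _]]; rewrite h /c ?connect0 ?orbT.
have cst : c s t by apply/connect1/exists_inP; exists e'.
case/or3P => [h|/andP[h h']|/andP[h h']]; rewrite ?h /=.
- by rewrite (connect_trans h cst : c u t).
- by rewrite (connect_trans h' cst : c b t) orbT.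
- by rewrite (connect_trans h' cst : c a t) !orbT.
Qed.

(** A new edge merges the classes of its two ends and changes nothing else, so the count drops by
    one exactly when these classes were distinct. *)
Lemma card_comps_add (S : {set Ed}) e a b : ends_in S -> a \in W -> b \in W ->
  (forall u v, joins e u v = ((u == a) && (v == b)) || ((u == b) && (v == a))) ->
  #|comps S| = (#|comps (e |: S)| + ~~ connect (adj joins S) a b)%N.
Proof.
move=> eS aW bW eab; have cE := connect_addU1 eS eab.
have cC := adj_sym eS.
case: (boolP (connect _ a b)) => [ab|nab] /=.
  rewrite addn0; congr #|pred_of_set _|; apply: eq_imset => v.
  apply/setP => w; rewrite !inE cE; apply/esym/orb_idr.
  case/orP => /andP[h1 h2].
    exact: connect_trans (connect_trans h1 ab) h2.
  by rewrite cC in ab; exact: connect_trans (connect_trans h1 ab) h2.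
pose C v := [set w | connect (adj joins S) v w].
(* [phi] fuses the classes of [a] and [b]; with [C b] deleted, [C a] is the only preimage of the
   fused class. *)
pose phi X := if (X == C a) || (X == C b) then C a :|: C b else X.
have CaS : C a \in comps S by exact: imset_f.
have CbS : C b \in comps S by exact: imset_f.
have Cab : C a != C b by rewrite comp_eqP.
have phiC v : phi (C v) = [set w | connect (adj joins (e |: S)) v w].
  rewrite /phi !comp_eqP //; apply/setP => w; rewrite [RHS]inE cE.
  case va: (connect _ v a) => /=.
    rewrite !inE -(same_connect cC va).
    by case: (connect _ v w); case: (connect _ b w); case: (connect _ v b).
  case vb: (connect _ v b) => /=; last by rewrite inE orbF.
  by rewrite !inE -(same_connect cC vb); case: (connect _ v w);
    case: (connect _ a w).
have -> : comps (e |: S) = phi @: (comps S :\ C b).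
  apply/setP => X; apply/imsetP/imsetP => [[v vW ->]|[Y]]; last first.
    by rewrite in_setD1 => /andP[_ /imsetP[v vW ->]] ->; exists v; rewrite // phiC.
  case: (eqVneq (C v) (C b)) => vb; last first.
    by exists (C v); rewrite ?phiC // in_setD1 vb imset_f.
  exists (C a); first by rewrite in_setD1 Cab.
  by rewrite -phiC vb /phi !eqxx orbT.
rewrite [in RHS]card_in_imset; first by rewrite addn1 (cardsD1 (C b) (comps S)) CbS.
(* Injectivity of [phi] away from [C b]: no other class can equal the fused one, since a class
   containing [C a] is [C a] itself. *)
have sub X : X \in comps S -> C a \subset X -> X = C a.
  case/imsetP => v _ -> /subsetP /(_ a); rewrite !inE connect0 => /(_ isT) va.
  by apply/eqP; rewrite comp_eqP.
move=> X Y; rewrite !in_setD1 /phi => /andP[/negPf -> XS] /andP[/negPf -> YS].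
rewrite !orbF; case: eqP => [->|_]; case: eqP => [->|_] // h.
  by apply/esym/sub => //; rewrite -h subsetUl.
by apply/sub => //; rewrite h subsetUl.
Qed.

Lemma comps0 : #|comps set0| = #|W|.
Proof.
rewrite card_in_imset // => u v _ _ /setP /(_ v); rewrite !inE connect0.
move=> c; apply: (connect_closed (Q := fun w => u = w) _ c) => // a b.
by case/exists_inP => e; rewrite inE.
Qed.

(** Without edges every vertex is its own class, and each added edge lowers the number of classes by
    at most one. *)
Lemma card_comps_ge S : ends_in S -> (#|W| <= #|S| + #|comps S|)%N.
Proof.
move: {2}#|S| (erefl #|S|) => k; elim: k S => [|k IH] S.
  by move/cards0_eq => ->; rewrite comps0 leq_addl.
move=> cS eS; have /card_gt0P[e eSS] : (0 < #|S|)%N by rewrite cS.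
have [a [b [aW bW eab]]] := eS _ eSS.
have eS' := ends_in_sub (subD1set S e) eS.
rewrite (cardsD1 e) eSS in cS *; case: cS => cS.
apply: leq_trans (IH _ cS eS') _.
rewrite (card_comps_add eS' aW bW eab) setD1K //.
by case: (connect _ a b) => /=; rewrite ?addn0 ?addn1 ?addnS ?addSn.
Qed.

(** * Cycles, bridges and the edge count of forests *)

Let walk (d d' : T * Ed) := joins d.2 d.1 d'.1.

(* [d] becomes a cycle once an edge [e] from [last u p] back to [u] is appended. *)
Lemma simple_path_edges (S : {set Ed}) u p : ends_in S ->
  path (adj joins S) u p -> uniq (u :: p) ->
  exists d : seq (T * Ed),
    [/\ map fst d = belast u p, uniq (map snd d), {subset map snd d <= S},
        (forall e a b, e \in map snd d -> joins e a b -> a \in u :: p) &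
        forall z e, walk z (u, e) -> path walk z (rcons d (last u p, e))].
Proof.
move=> eS; elim: p u => [|v p IH] u /=.
  by exists [::]; split=> // z e; rewrite /walk /= => ->.
case/andP=> /exists_inP[e1 e1S e1uv] pth /andP[up upp].
have [d [d1 d2 d3 d4 d5]] := IH v pth upp.
exists ((u, e1) :: d); split=> /=.
- by rewrite d1.
- rewrite d2 andbT; apply: contra up => e1d; exact: d4 e1d e1uv.
- by move=> e; rewrite inE => /predU1P[->|/d3].
- move=> e a b; rewrite inE => /predU1P[->|/d4 h /h].
    have [s [t [_ _ jE]]] := eS _ e1S; move: e1uv; rewrite !jE.
    by case/orP => /andP[/eqP -> /eqP ->] /orP[] /andP[/eqP -> _];
      rewrite !inE eqxx ?orbT.
  by move=> av; rewrite in_cons av orbT.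
- move=> z e zu; apply/andP; split; [exact: zu|exact: d5].
Qed.

(** A simple path from [b] back to [a] that avoids [e] would be closed by [e] into a cycle. *)
Lemma acyclic_bridge (S : {set Ed}) e a b : ends_in S -> mg_acyclic joins S ->
  e \in S -> joins e a b -> ~~ connect (adj joins (S :\ e)) a b.
Proof.
move=> eS acS eSS eab; apply/negP => cab; apply: acS.
have eS' := ends_in_sub (subD1set S e) eS.
rewrite (adj_sym eS') in cab; case/connectP: cab => p0 /shortenP[p pth up _] E.
have [d [d1 d2 d3 _ d5]] := simple_path_edges eS' pth up.
exists ((a, e) :: d); last first.
  by move=> f; rewrite inE => /predU1P[->//|/d3]; rewrite inE => /andP[].
split=> //=.
- by rewrite {2}E; exact: d5.
- rewrite d1; have : uniq (rcons (belast b p) a) by rewrite E -lastI.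
  by rewrite rcons_uniq.
- by rewrite d2 andbT; apply/negP => /d3; rewrite !inE eqxx.
Qed.

(** Every edge of an acyclic set is a bridge, so each removal raises the number of classes by
    exactly one. *)
Lemma card_comps_acyclic S : ends_in S -> mg_acyclic joins S ->
  #|W| = (#|S| + #|comps S|)%N.
Proof.
move: {2}#|S| (erefl #|S|) => k; elim: k S => [|k IH] S.
  by move/cards0_eq => -> _ _; rewrite comps0 cards0.
move=> cS eS acS; have /card_gt0P[e eSS] : (0 < #|S|)%N by rewrite cS.
have [a [b [aW bW eab]]] := eS _ eSS.
have eS' := ends_in_sub (subD1set S e) eS.
have nab : ~~ connect (adj joins (S :\ e)) a b.
  by apply: acyclic_bridge; rewrite // eab !eqxx.
rewrite (cardsD1 e) eSS in cS *; case: cS => cS.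
rewrite (IH _ cS eS'); last first.
  case=> p pc ps; apply: acS; exists p => // f /ps.
  by rewrite inE => /andP[].
by rewrite (card_comps_add eS' aW bW eab) setD1K // nab add1n addn1 addSnnS.
Qed.

(** The edge of [z] is kept outside [S]. Applied to a cycle starting and ending at [z], this shows
    that the ends of its first edge stay connected through the remaining edges. *)
Lemma walk_connect (S : {set Ed}) z d z' : path walk z (rcons d z') ->
  {subset map snd d <= S} ->
  exists2 v, joins z.2 z.1 v & connect (adj joins S) v z'.1.
Proof.
elim: d z => [|[v e] d IH] z /=; first by rewrite andbT => zz' _; exists z'.1.
case/andP => zv /IH{}IH sub.
have [|w evw wz'] := IH; first by move=> f fd; apply: sub; rewrite inE fd orbT.
exists v => //; apply: connect_trans (connect1 _) wz'.
by apply/exists_inP; exists e => //; apply: sub; rewrite mem_head.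
Qed.

(** An edge on a cycle could be deleted without changing the classes, leaving too few edges for
    [card_comps_ge]. *)
Lemma card_comps_eq_acyclic S : ends_in S ->
  (#|S| + #|comps S| <= #|W|)%N -> mg_acyclic joins S.
Proof.
move=> eS le [[|[v e] d] [//= _ pc _ /andP[ed ud] sub]].
have eSS : e \in S by apply: sub; rewrite mem_head.
have [] := walk_connect (S := S :\ e) pc.
  move=> f fd; rewrite !inE sub ?inE ?fd ?orbT // andbT.
  by apply: contraNneq ed => <-.
move=> w /= evw; have eS' := ends_in_sub (subD1set S e) eS.
have [a [b [aW bW eab]]] := eS _ eSS => cwv.
have cab : connect (adj joins (S :\ e)) a b.
  rewrite eab in evw; case/orP: evw => /andP[/eqP va /eqP wb].
    by rewrite (adj_sym eS') -va -wb.
  by rewrite -va -wb.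
have := card_comps_ge eS'.
rewrite (card_comps_add eS' aW bW eab) cab setD1K // addn0.
by move: le; rewrite (cardsD1 e S) eSS add1n addSn => le /(leq_trans le); rewrite ltnn.
Qed.

Lemma card_comps_connected S : ends_in S -> W != set0 ->
  mg_connected joins W S -> #|comps S| = 1%N.
Proof.
move=> eS /set0Pn[v vW] conn; apply/eqP/cards1P.
exists [set u | connect (adj joins S) v u].
apply/setP => X; rewrite inE; apply/imsetP/eqP => [[u uW ->]|->]; last by exists v.
by apply/eqP; rewrite comp_eqP //; exact: conn.
Qed.

End CountingComponents.

(** * The matrix-tree theorem *)

Section CauchyBinet.
Variables (A : comNzRingType) (I : finType) (n : nat).
Variables (w : I -> A) (b : I -> 'I_n -> A).

Let B (f : 'I_n -> I) : 'M[A]_n := \matrix_(i, j) b (f i) j.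

(** Multilinearity in the rows: distributing the Leibniz products over the sums selects one index
    [f i] for each row. *)
Lemma det_gram_sum :
  \det (\matrix_(i, j) \sum_(e : I) w e * b e i * b e j) =
  \sum_(f : {ffun 'I_n -> I}) (\prod_i (w (f i) * b (f i) i)) * \det (B f).
Proof.
rewrite /determinant.
under [RHS]eq_bigr do rewrite mulr_sumr.
rewrite exchange_big /=; apply: eq_bigr => s _.
under eq_bigr do rewrite mxE.
rewrite bigA_distr_bigA /= mulr_sumr; apply: eq_bigr => f _.
rewrite mulrCA -big_split /=; congr (_ * _); apply: eq_bigr => i _.
by rewrite mxE.
Qed.

(** The injections with the image of [g] are the composites of [g] with permutations. Their
    determinants differ from that of [B g] by the sign, and the signed products add up to a second
    factor [\det (B g)]. *)
Lemma det_gram_fiber (g : 'I_n -> I) : injective g ->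
  \sum_(f : {ffun 'I_n -> I} | injectiveb f && (f @: setT == g @: setT))
    (\prod_i (w (f i) * b (f i) i)) * \det (B f) =
  (\prod_(e in g @: setT) w e) * \det (B g) ^+ 2.
Proof.
move=> ginj.
pose h (s : {perm 'I_n}) : {ffun 'I_n -> I} := [ffun i => g (s i)].
(* The default [1%g] is never reached on the functions being summed, since each of them is some
   [h s]. *)
pose k (f : {ffun 'I_n -> I}) : {perm 'I_n} :=
  odflt 1%g [pick s : {perm 'I_n} | h s == f].
rewrite (reindex_onto h k) /=; last first.
  move=> f /andP[/injectiveP finj /eqP im].
  rewrite /k; case: pickP => [s /eqP //|no].
  have fg i : exists j, g j == f i.
    have : f i \in g @: setT by rewrite -im imset_f.
    by case/imsetP => j _ ->; exists j.
  pose p i := xchoose (fg i).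
  have pE i : g (p i) = f i by exact/eqP/(xchooseP (fg i)).
  have pinj : injective p by move=> i j pij; apply: finj; rewrite -!pE pij.
  have /eqP[] := no (perm pinj).
  by apply/ffunP => i; rewrite ffunE permE pE.
have kh s : k (h s) = s.
  rewrite /k; case: pickP => [t /eqP /ffunP ts|/(_ s)]; last by rewrite eqxx.
  by apply/permP => i; have := ts i; rewrite !ffunE => /ginj.
have himg s : h s @: setT = g @: setT.
  apply/setP => e; apply/imsetP/imsetP => [[i _ ->]|[i _ ->]].
    by exists (s i); rewrite // ffunE.
  by exists (s^-1%g i); rewrite // ffunE permKV.
rewrite (eq_bigl xpredT) => [|s]; last first.
  rewrite kh eqxx himg eqxx !andbT; apply/injectiveP => i j.
  by rewrite !ffunE => /ginj /perm_inj.
have Bh s : \det (B (h s)) = (-1) ^+ s * \det (B g).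
  have -> : B (h s) = row_perm s (B g).
    by apply/matrixP => i j; rewrite !mxE ffunE.
  by rewrite row_permE det_mulmx det_perm.
have wh s : \prod_i (w (h s i) * b (h s i) i) =
   (\prod_(e in g @: setT) w e) * \prod_i B g (s i) i.
  rewrite big_split /=; congr (_ * _); last first.
    by apply: eq_bigr => i _; rewrite mxE ffunE.
  rewrite -(himg s) big_imset /=; last first.
    by move=> i j _ _; rewrite !ffunE => /ginj /perm_inj.
  by apply: eq_bigl => i; rewrite inE.
under eq_bigr do rewrite Bh wh -mulrA.
rewrite -mulr_sumr expr2; congr (_ * _).
(* Transposing one factor makes its Leibniz products run over the entries [B g (s i) i] obtained on
   the left. *)
rewrite -[X in _ = _ * X]det_tr /determinant mulr_sumr.
apply: eq_bigr => s _; rewrite [LHS]mulrC -mulrA [RHS]mulrCA. congr (_ * (_ * _)).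
by apply: eq_bigr => i _; rewrite [RHS]mxE.
Qed.

(** Selections with a repeated index give equal rows and vanish; the others are grouped by image.
    Taking the squared minor as a function [d] of the image avoids fixing an enumeration of each set
    in the statement. *)
Lemma det_gram (d : {set I} -> A) :
  (forall g : 'I_n -> I, injective g -> \det (B g) ^+ 2 = d (g @: setT)) ->
  \det (\matrix_(i, j) \sum_(e : I) w e * b e i * b e j) =
  \sum_(S : {set I} | #|S| == n) (\prod_(e in S) w e) * d S.
Proof.
move=> dE; rewrite det_gram_sum.
rewrite (bigID (fun f : {ffun 'I_n -> I} => injectiveb f)) /=.
rewrite [X in _ + X]big1 ?addr0 => [|f /injectivePn[i [j ij fij]]]; last first.
  rewrite (determinant_alternate ij) ?mulr0 // => l.
  by rewrite !mxE fij.
rewrite (partition_big (fun f : {ffun 'I_n -> I} => f @: setT)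
   (fun S : {set I} => #|S| == n)) /=; last first.
  by move=> f /injectiveP finj; rewrite card_imset // cardsT card_ord.
apply: eq_bigr => S /eqP cS.
pose g (i : 'I_n) : I := enum_val (cast_ord (esym cS) i).
have ginj : injective g by move=> i j /enum_val_inj /cast_ord_inj.
have gS : g @: setT = S.
  apply/eqP; rewrite eqEcard card_imset // cardsT card_ord cS leqnn andbT.
  by apply/subsetP => e /imsetP[i _ ->]; exact: enum_valP.
by rewrite -[in LHS]gS det_gram_fiber // dE // gS.
Qed.

End CauchyBinet.

(** * Grounded incidence matrices and spanning trees *)

Section MatrixTree.
Variables (T Ed : finType) (r0 : T) (a b : Ed -> T).

Let n := #|T|.
(* [None] is the edge that grounds [r0]. *)
Let inc (A : pzRingType) (e : option Ed) (v : T) : A :=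
  if e is Some e' then (v == b e')%:R - (v == a e')%:R else (v == r0)%:R.

Let joins e : rel T := fun u v =>
  ((u == a e) && (v == b e)) || ((u == b e) && (v == a e)).

Let spans (S : {set option Ed}) : bool :=
  (None \in S) && [forall v, connect (adj joins (Some @^-1: S)) r0 v].

(** The entries are integers, so minors are evaluated once over [int] and carried to any ring by the
    canonical morphism. *)
Let Bint (g : 'I_n -> option Ed) : 'M[int]_n :=
  \matrix_(i, j) inc int (g i) (enum_val j).

(* Following paths from r0, every unit vector is an integral combination of the
   rows, so the matrix is invertible over the integers. *)
Lemma det_incidence_spans (g : 'I_n -> option Ed) : spans (g @: setT) ->
  \det (Bint g) ^+ 2 = 1.
Proof.
case/andP => /imsetP[i0 _ gi0] /forallP conn.
pose d v : 'rV[int]_n := \row_j (enum_val j == v)%:R.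
have ex v : exists z : 'rV[int]_n, z *m Bint g == d v.
  apply: (connect_closed (Q := fun v => exists z, z *m Bint g == d v) _ (conn v)).
    move=> u {}v /exists_inP[e]; rewrite inE => /imsetP[i _ gi] uv [z /eqP zu].
    have di : delta_mx 0 i *m Bint g = d (b e) - d (a e).
      by rewrite -rowE; apply/rowP => j; rewrite !mxE -gi.
    case/orP: uv => /andP[/eqP ua /eqP vb].
      by exists (z + delta_mx 0 i); rewrite mulmxDl zu di ua vb addrC subrK.
    by exists (z - delta_mx 0 i); rewrite mulmxBl zu di ua vb subKr.
  exists (delta_mx 0 i0); apply/eqP; rewrite -rowE; apply/rowP => j.
  by rewrite !mxE -gi0.
pose C : 'M[int]_n := \matrix_i xchoose (ex (enum_val i)).
have CB : C *m Bint g = 1%:M.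
  apply/row_matrixP => i; rewrite row_mul rowK (eqP (xchooseP (ex _))).
  by apply/rowP => j; rewrite !mxE (inj_eq enum_val_inj) eq_sym.
have := congr1 determinant CB; rewrite det_mulmx det1 mulrC => dd.
(* The units of [int] are 1 and -1, so the square is 1. *)
have : \det (Bint g) \is a GRing.unit by apply/unitrP; exists (\det C); rewrite dd mulrC.
by case/orP => /eqP ->; rewrite ?sqrrN expr1n.
Qed.

(* The kernel contains a constant vector if r0 is not grounded, and otherwise the
   indicator of the vertices that r0 does not reach. *)
Lemma det_incidence_nspans (g : 'I_n -> option Ed) : ~~ spans (g @: setT) ->
  \det (Bint g) = 0.
Proof.
set S := g @: setT.
have gS i : g i \in S by exact: imset_f.
suff kill (f : T -> int) v : f v != 0 -> (None \in S -> f r0 = 0) ->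
    (forall e, Some e \in S -> f (a e) = f (b e)) -> \det (Bint g) = 0.
  rewrite negb_and; case: (boolP (None \in S)) => [NS /=|NS _]; last first.
    by apply: (kill (fun=> 1) r0) => //; rewrite (negPf NS).
  move/forallPn => [v nv].
  apply: (kill (fun u => (~~ connect (adj joins (Some @^-1: S)) r0 u)%:R) v).
  - by rewrite nv.
  - by rewrite connect0.
  - move=> e eS; have ab : adj joins (Some @^-1: S) (a e) (b e).
      by apply/exists_inP; exists e; rewrite ?inE // /joins !eqxx.
    have ba : adj joins (Some @^-1: S) (b e) (a e).
      by apply/exists_inP; exists e; rewrite ?inE // /joins !eqxx orbT.
    congr (~~ _)%:R; apply/idP/idP => h; apply: connect_trans h _; exact: connect1.
move=> fv fN fS; pose F : 'cV[int]_n := \col_i f (enum_val i).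
have sumd u : \sum_j (enum_val j == u)%:R * F j 0 = f u.
  rewrite (bigD1 (enum_rank u)) //= mxE enum_rankK eqxx mul1r big1 ?addr0 //.
  move=> j ju; case: eqP => [ju'|_]; last by rewrite mul0r.
  by case/eqP: ju; rewrite -ju' enum_valK.
rewrite -det_tr; apply/eqP/det0P; exists F^T.
  apply: contra_neq fv => /rowP /(_ (enum_rank v)).
  by rewrite !mxE enum_rankK.
rewrite -trmx_mul -[RHS]trmx0; congr _^T.
apply/colP => i; rewrite !mxE; have := gS i; case ge: (g i) => [e|] giS.
  transitivity (\sum_j ((enum_val j == b e)%:R * F j 0
      - (enum_val j == a e)%:R * F j 0)).
    by apply: eq_bigr => j _; rewrite mxE ge /= mulrBl.
  by rewrite sumrB !sumd fS // subrr.
transitivity (\sum_j (enum_val j == r0)%:R * F j 0).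
  by apply: eq_bigr => j _; rewrite mxE ge.
by rewrite sumd fN.
Qed.

Lemma spans_connected (S : {set Ed}) :
  [forall v, connect (adj joins S) r0 v] = `[< mg_connected joins setT S >].
Proof.
apply/forallP/asboolP => [h u v _ _|h v]; last by apply: h; rewrite inE.
rewrite (connect_trans _ (h v)) // (@adj_sym _ _ joins setT) //.
by move=> e _; exists (a e), (b e); rewrite !inE.
Qed.

(** Cauchy-Binet over the edges and the grounding edge, which has weight 1. Connectedness together
    with [#|T| - 1] edges expresses that [S] is a spanning tree. *)
Lemma matrix_tree (A : comNzRingType) (w : Ed -> A) :
  \det (\matrix_(i < n, j < n) ((enum_val i == r0)%:R * (enum_val j == r0)%:R +
    \sum_e w e * ((enum_val i == b e)%:R - (enum_val i == a e)%:R)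
               * ((enum_val j == b e)%:R - (enum_val j == a e)%:R))) =
  \sum_(S : {set Ed} | (#|S|.+1 == #|T|) && `[< mg_connected joins setT S >])
     \prod_(e in S) w e.
Proof.
pose wo e := if e is Some e' then w e' else 1.
pose bo e (j : 'I_n) := inc A e (enum_val j).
transitivity (\det (\matrix_(i < n, j < n) \sum_e wo e * bo e i * bo e j)).
  congr (\det _); apply/matrixP => i j; rewrite !mxE.
  rewrite [RHS](bigD1 None) //= mul1r; congr (_ + _).
  rewrite (reindex_omap Some id) //=; last by case.
  by apply: eq_bigl => e; rewrite eqxx.
rewrite (@det_gram A _ n wo bo (fun S => (spans S)%:R)); last first.
  move=> g ginj.
  have -> : \matrix_(i, j) bo (g i) j = map_mx intr (Bint g).
    apply/matrixP => i j; rewrite !mxE /bo; case: (g i) => [e|] /=.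
      by rewrite rmorphB /= !rmorph_nat.
    by rewrite rmorph_nat.
  rewrite det_map_mx -rmorphXn /=; case: (boolP (spans _)) => h.
    by rewrite det_incidence_spans.
  by rewrite det_incidence_nspans // expr0n.
rewrite (bigID (fun S : {set option Ed} => spans S)) /=.
rewrite [X in _ + X]big1 ?addr0 => [|S /andP[_ /negPf ->]]; last by rewrite mulr0.
(* Every contributing set contains the grounding edge, hence is [h S] for the set [S] of its
   ordinary edges. *)
pose h (S : {set Ed}) : {set option Ed} := None |: Some @: S.
have hN S : (None \in Some @: S) = false by apply/imsetP => -[].
have hS S e : (Some e \in h S) = (e \in S).
  by rewrite !inE /= mem_imset // => x y [].
rewrite (reindex_onto h (fun S => Some @^-1: S)) /=; last first.
  move=> S /andP[_ /andP[NS _]]; apply/setP => -[e|]; first by rewrite hS inE.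
  by rewrite !inE eqxx NS.
have hK S : Some @^-1: h S = S by apply/setP => e; rewrite inE hS.
apply: eq_big => [S|S /andP[/andP[_ ->] _]].
  rewrite /spans hK eqxx andbT spans_connected !inE eqxx /=.
  by rewrite cardsU1 hN card_imset ?add1n // => x y [].
rewrite mulr1 big_setU1 ?hN //= mul1r big_imset //= => x y _ _ [] //.
Qed.

End MatrixTree.

(** * Forests of the network and trees of the augmented graph *)

Section Forests.
Variables (R : realType) (V : finType) (E : {set {set V}}).
Variables (M : {set V}) (P : {set {set V}}) (r : {set V} -> V).
Variables (q : nat) (x : 'I_q -> V).
Hypothesis (E2 : simple_graph E) (M0 : M != set0) (PM : partition P M).
Hypothesis (rP : forall A, A \in P -> r A \in A).
Hypothesis (x_inj : injective x).
Hypothesis (xN : [set x i | i : 'I_q] = nonroots M P r).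
Implicit Types (F : {set {set V}}) (J : {set 'I_q}).

Definition port_rel (J : {set 'I_q}) : rel V := fun u v =>
  [exists i in J, ((u == root_of P r (x i)) && (v == x i)) ||
                  ((u == x i) && (v == root_of P r (x i)))].

Definition augmented_rel (F : {set {set V}}) (J : {set 'I_q}) : rel V :=
  fun u v => adj (@link V) F u v || port_rel J u v.

(** A tree is encoded as a connected graph with [#|V| - 1] edges. Network and port edges are counted
    separately, so a port edge parallel to an edge of [F] still counts. *)
Definition augmented_tree (F : {set {set V}}) (J : {set 'I_q}) : Prop :=
  (#|F| + #|J|).+1 = #|V| /\ forall u v, connect (augmented_rel F J) u v.

Lemma link_ends (e : {set V}) : #|e| = 2%N -> exists a b, e = [set a; b] /\
  forall u v, link e u v = ((u == a) && (v == b)) || ((u == b) && (v == a)).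
Proof.
move/eqP/cards2P => [a [b [ab ->]]]; exists a, b; split=> // u v; rewrite /link.
apply/eqP/idP => [h|]; last first.
  by case/orP => /andP[/eqP -> /eqP ->] //; rewrite setUC.
move/setP: h => h; have := h b; have := h a; rewrite !inE !eqxx orbT.
move=> /esym/orP[] /eqP av /esym/orP[] /eqP bv; move: ab; rewrite av bv ?eqxx //.
by rewrite orbT.
Qed.

Lemma link_ends_in (F : {set {set V}}) : F \subset E ->
  ends_in (@link V) [set: V] F.
Proof.
move=> /subsetP FE e /FE /E2 /link_ends[a [b [_ ab]]].
by exists a, b; rewrite !inE.
Qed.

Lemma augmented_sym F J : F \subset E -> connect_sym (augmented_rel F J).
Proof.
move=> FE; apply: sym_connect_sym => u v; rewrite /augmented_rel.
congr (_ || _).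
  by apply: eq_existsb => e; rewrite /link setUC.
apply: eq_existsb => i; congr (_ && _); rewrite orbC.
by congr (_ || _); rewrite andbC.
Qed.

Lemma comps_link F : comps (@link V) [set: V] F = components F.
Proof. by apply/setP => X; apply/imsetP/imsetP => -[v _ ->]; exists v. Qed.

Lemma component_eqP F u v : F \subset E ->
  (component F u == component F v) = connect (adj (@link V) F) u v.
Proof. by move=> FE; apply: comp_eqP; exact: link_ends_in. Qed.

Lemma connect_augmented F J u v :
  connect (adj (@link V) F) u v -> connect (augmented_rel F J) u v.
Proof.
by apply: connect_sub => a b ab; apply: connect1; rewrite /augmented_rel ab.
Qed.

Lemma hlink_ends_in F J : ends_in (hlink P r F) (components F) (x @: J).
Proof.
move=> _ /imsetP[i _ ->].
exists (component F (root_of P r (x i))), (component F (x i)).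
split; [exact: imset_f|exact: imset_f|move=> a b].
rewrite /hlink !(eq_sym a) !(eq_sym b); congr (_ || _).
by rewrite andbC.
Qed.

Lemma hlink_connect F J u v : F \subset E ->
  connect (adj (hlink P r F) (x @: J)) (component F u) (component F v)
  = connect (augmented_rel F J) u v.
Proof.
move=> FE; apply: (connect_quotient (h := component F)) => {u v}.
- move=> u v /orP[uv|/exists_inP[i iJ uv]].
    suff -> : component F u = component F v by exact: connect0.
    by apply/eqP; rewrite component_eqP //; exact: connect1.
  apply/connect1/exists_inP; exists (x i); first exact: imset_f.
  by case/orP: uv => /andP[/eqP -> /eqP ->]; rewrite /hlink !eqxx ?orbT.
- by move=> u v /eqP; rewrite component_eqP //; exact: connect_augmented.
- move=> X Y /exists_inP[_ /imsetP[i iJ ->]].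
  case/orP => /andP[/eqP <- /eqP <-].
    exists (root_of P r (x i)), (x i); split=> //.
    apply/connect1/orP; right; apply/exists_inP; exists i => //.
    by rewrite !eqxx.
  exists (x i), (root_of P r (x i)); split=> //.
  apply/connect1/orP; right; apply/exists_inP; exists i => //.
  by rewrite !eqxx orbT.
Qed.

Lemma hlink_connected F J : F \subset E ->
  mg_connected (hlink P r F) (components F) (x @: J) <->
  forall u v, connect (augmented_rel F J) u v.
Proof.
move=> FE; split=> [h u v|h _ _ /imsetP[u _ ->] /imsetP[v _ ->]].
  by rewrite -hlink_connect //; apply: h; exact: imset_f.
by rewrite hlink_connect.
Qed.

Lemma components_neq0 F : components F != set0.
Proof.
by case/set0Pn: M0 => v _; apply/set0Pn; exists (component F v); exact: imset_f.
Qed.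

Lemma card_components_le F (J : {set 'I_q}) : F \subset E ->
  (forall u v, connect (augmented_rel F J) u v) -> (#|components F| <= #|J|.+1)%N.
Proof.
move=> FE /(hlink_connected J FE) conn.
have eS := @hlink_ends_in F J.
have := card_comps_ge eS.
by rewrite (card_comps_connected eS (components_neq0 F) conn) addn1 (card_imset _ x_inj).
Qed.

(** Connectedness of the port graph bounds the number of components above by [#|J| + 1], and the
    edge count of [F] bounds it below by the same number. Equality in the second bound makes [F]
    acyclic. *)
Lemma augmented_tree_forest F J : F \subset E -> augmented_tree F J ->
  spanning_forest E F /\ #|components F| = #|J|.+1.
Proof.
move=> FE [cV conn]; have eF := link_ends_in FE.
have le := card_components_le FE conn.
have ge := card_comps_ge eF; rewrite comps_link cardsT -cV in ge.
have cF : #|components F| = #|J|.+1.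
  by apply/eqP; rewrite eqn_leq le /= -(leq_add2l #|F|) addnS.
split=> //; split=> //; apply: (card_comps_eq_acyclic eF).
by rewrite comps_link cF cardsT -cV addnS.
Qed.

Lemma card_nonroots : #|nonroots M P r| = q.
Proof. by rewrite -xN card_imset // card_ord. Qed.

(** The index set consists of the ports left out, so the tree uses the port edges in [J]. A forest
    with [#|J| + 1] components has [#|V| - #|J| - 1] edges; conversely the edge counts force
    acyclicity in both [F] and the port graph. *)
Lemma psi_forestP F (J : {set 'I_q}) :
  psi_forest E M P r (x @: ~: J) F <-> F \subset E /\ augmented_tree F J.
Proof.
have NJ : nonroots M P r :\: (x @: ~: J) = x @: J.
  rewrite -xN; apply/setP => v; rewrite inE; apply/andP/imsetP => [[vJ]|[i iJ ->]].
    case/imsetP => i _ vi; exists i => //; apply: contraNT vJ => iJ.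
    by rewrite vi imset_f // inE.
  by split; [rewrite mem_imset // inE iJ|exact: imset_f].
have cJ : (#|nonroots M P r| - #|x @: ~: J| + 1)%N = #|J|.+1.
  rewrite card_nonroots (card_imset _ x_inj) addn1.
  by rewrite -[X in (X - _)%N](card_ord q) -(cardsC J) addnK.
rewrite /psi_forest NJ cJ; split.
  case=> -[FE acF] cF [conn _]; split=> //; split; last exact/hlink_connected.
  have := card_comps_acyclic (link_ends_in FE) acF.
  by rewrite cardsT comps_link cF addnS.
case=> FE FJ; have [sF cF] := augmented_tree_forest FE FJ.
split=> //; case: FJ => _ /(hlink_connected J FE) conn; split=> //.
have eS := @hlink_ends_in F J.
apply: (card_comps_eq_acyclic eS).
rewrite (card_comps_connected eS (components_neq0 F) conn) addn1 cF.
by rewrite (card_imset _ x_inj).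
Qed.

(** * Superport identification and valid forests *)

Lemma mem_block A v : A \in P -> v \in A -> pblock P v = A.
Proof. by case/and3P: PM => _ tP _; exact: def_pblock. Qed.

Lemma block_sub A v : A \in P -> v \in A -> v \in M.
Proof.
by case/and3P: PM => /eqP <- _ _ AP vA; apply/bigcupP; exists A.
Qed.

Lemma pblock_M v : v \in M -> pblock P v \in P /\ v \in pblock P v.
Proof.
case/and3P: PM => /eqP cP _ _ vM.
by rewrite pblock_mem ?mem_pblock cP.
Qed.

Lemma connect_root v : v \in M -> connect (port_rel setT) (root_of P r v) v.
Proof.
move=> vM; have [AP vA] := pblock_M vM.
case: (boolP (v \in nonroots M P r)) => [|].
  rewrite -xN => /imsetP[i _ vi]; apply/connect1/exists_inP; exists i => //.
  by rewrite vi !eqxx.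
rewrite inE vM andbT negbK => /imsetP[B BP vB].
have -> : root_of P r v = v by rewrite /root_of vB (mem_block BP (rP BP)).
exact: connect0.
Qed.

Lemma root_of_M v : v \in M ->
  root_of P r v \in M /\ pblock P (root_of P r v) = pblock P v.
Proof.
move=> vM; have [AP vA] := pblock_M vM.
have rA : root_of P r v \in pblock P v := rP AP.
by split; [exact: block_sub AP rA|exact: mem_block AP rA].
Qed.

Lemma qvertex_root i : qvertex M P (root_of P r (x i)) = qvertex M P (x i).
Proof.
have : x i \in nonroots M P r by rewrite -xN imset_f.
rewrite inE => /andP[_ xM]; have [rM rE] := root_of_M xM.
by rewrite /qvertex xM rM rE.
Qed.

Lemma qvertex_connect F u v : F \subset E -> qvertex M P u = qvertex M P v ->
  connect (augmented_rel F setT) u v.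
Proof.
move=> FE; have cC := augmented_sym setT FE.
have pc s t : connect (port_rel setT) s t -> connect (augmented_rel F setT) s t.
  by apply: connect_sub => a b ab; apply: connect1; rewrite /augmented_rel ab orbT.
(* Superports lie inside [M], so the two encodings of quotient vertices never clash. *)
have nM s t : s \in M -> t \notin M -> pblock P s = [set t] -> False.
  move=> sM tM E'; have [AP _] := pblock_M sM.
  by case/negP: tM; apply: (block_sub AP); rewrite E' inE.
rewrite /qvertex; case: ifPn => uM; case: ifPn => vM.
- move=> E'; apply: (@connect_trans _ _ (root_of P r u)).
    by rewrite cC; apply/pc/connect_root.
  by rewrite /root_of E'; exact/pc/connect_root.
- by move/(nM _ _ uM vM).
- by move/esym/(nM _ _ vM uM).
- by move/setP/(_ u); rewrite !inE eqxx => /esym/eqP ->; exact: connect0.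
Qed.

(** For reachability, identifying each superport amounts to adding all port edges, which join every
    nonroot to its root. *)
Lemma qlink_connect F u v : F \subset E ->
  connect (adj (qlink M P) F) (qvertex M P u) (qvertex M P v)
  = connect (augmented_rel F setT) u v.
Proof.
move=> FE; apply: (connect_quotient (h := qvertex M P)) => {u v}.
- move=> u v /orP[/exists_inP[e eF uv]|/exists_inP[i _ uv]].
    apply/connect1/exists_inP; exists e => //; apply/existsP; exists u.
    by apply/existsP; exists v; rewrite uv !eqxx.
  by case/orP: uv => /andP[/eqP -> /eqP ->]; rewrite qvertex_root connect0.
- by move=> u v; exact: qvertex_connect.
- move=> X Y /exists_inP[e eF /existsP[u /existsP[v /and3P[uv /eqP uX /eqP vY]]]].
  exists u, v; split=> //; apply/connect1/orP; left.
  by apply/exists_inP; exists e.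
Qed.

(** Roots and interior vertices together represent each quotient vertex exactly once; the [q]
    nonroots are what remains. *)
Lemma card_qvertex : (#|[set qvertex M P v | v : V]| + q)%N = #|V|.
Proof.
have -> : [set qvertex M P v | v : V] = qvertex M P @: ~: nonroots M P r.
  apply/setP => X; apply/imsetP/imsetP => -[v vN ->]; last by exists v.
  case: (boolP (v \in nonroots M P r)) => [|vN']; last by exists v; rewrite // inE.
  rewrite -xN => /imsetP[i _ ->]; exists (root_of P r (x i));
    last by rewrite qvertex_root.
  have : x i \in nonroots M P r by rewrite -xN imset_f.
  rewrite !inE => /andP[_ xM]; have [AP _] := pblock_M xM.
  by rewrite xN inE negb_and negbK /root_of imset_f.
rewrite card_in_imset; first by rewrite -card_nonroots addnC cardsC.
move=> u v; rewrite !inE !negb_and !negbK => uR vR uv.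
have rM A : A \in P -> r A \in M by move=> AP; apply: (block_sub AP); exact: rP.
have qr A : A \in P -> qvertex M P (r A) = A.
  by move=> AP; rewrite /qvertex rM //; apply: mem_block => //; exact: rP.
have nM s A : s \notin M -> A \in P -> [set s] = A -> False.
  by move=> sM AP sA; case/negP: sM; apply: (block_sub AP); rewrite -sA inE.
case/orP: uR uv => [/imsetP[A AP ->]|uM]; case/orP: vR => [/imsetP[B BP ->]|vM].
- by rewrite !qr // => ->.
- by rewrite qr // /qvertex (negPf vM) => /esym /(nM _ _ vM AP).
- by rewrite qr // /qvertex (negPf uM) => /(nM _ _ uM BP).
- rewrite /qvertex (negPf uM) (negPf vM) => /setP/(_ u); rewrite !inE eqxx.
  by move/esym/eqP.
Qed.

Lemma qlink_ends_in F : F \subset E ->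
  ends_in (qlink M P) [set qvertex M P v | v : V] F.
Proof.
move=> /subsetP FE e /FE /E2 /link_ends[a [b [_ ab]]].
exists (qvertex M P a), (qvertex M P b); split; try exact: imset_f.
move=> X Y; apply/existsP/idP => [[u /existsP[v /and3P[]]]|].
  rewrite ab => uv /eqP <- /eqP <-.
  by case/orP: uv => /andP[/eqP -> /eqP ->]; rewrite !eqxx ?orbT.
case/orP => /andP[/eqP -> /eqP ->].
  by exists a; apply/existsP; exists b; rewrite ab !eqxx.
by exists b; apply/existsP; exists a; rewrite ab !eqxx orbT.
Qed.

(** A spanning tree of the quotient has one edge fewer than the quotient has vertices; adding [q]
    port edges gives [#|V| - 1] by [card_qvertex]. *)
Lemma validP F : valid E M P F <-> F \subset E /\ augmented_tree F setT.
Proof.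
have W0 : [set qvertex M P v | v : V] != set0.
  by case/set0Pn: M0 => v _; apply/set0Pn; exists (qvertex M P v); exact: imset_f.
have cq : #|[set: 'I_q]| = q by rewrite cardsT card_ord.
split.
  case=> -[FE acF] [conn acQ]; split=> //; have eQ := qlink_ends_in FE.
  split; last first.
    by move=> u v; rewrite -qlink_connect //; apply: conn; exact: imset_f.
  have := card_comps_acyclic eQ acQ.
  rewrite (card_comps_connected eQ W0 conn) -card_qvertex cq => ->.
  by rewrite addn1 addSn.
case=> FE FT; have [sF _] := augmented_tree_forest FE FT.
split=> //; case: FT; rewrite cq -card_qvertex => /eqP.
rewrite -addSn eqn_add2r => /eqP cW conn; have eQ := qlink_ends_in FE.
have mc : mg_connected (qlink M P) [set qvertex M P v | v : V] F.
  by move=> _ _ /imsetP[u _ ->] /imsetP[v _ ->]; rewrite qlink_connect.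
split=> //; apply: (card_comps_eq_acyclic eQ).
by rewrite (card_comps_connected eQ W0 mc) -cW addn1.
Qed.

(** This merges the separately defined empty case with the others: both count augmented trees whose
    port edges are the complement of [I]. *)
Lemma Psi_augmented (c : {set V} -> R) (I : {set 'I_q}) :
  Psi E c M P r (x @: I) =
  \sum_(F : {set {set V}} | (F \subset E) && `[< augmented_tree F (~: I) >]) weight c F.
Proof.
rewrite /Psi imset_eq0; case: eqP => [->|_]; apply: eq_bigl => F.
  rewrite setC0; apply/asboolP/andP => [/validP[FE h]|[FE /asboolP h]].
    by split=> //; apply/asboolP.
  exact/validP.
rewrite -{1}(setCK I); apply/asboolP/andP => [/psi_forestP[FE h]|[FE /asboolP h]].
  by split=> //; apply/asboolP.
exact/psi_forestP.
Qed.

End Forests.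

(** * Port impedance and response *)

(** Sylvester's identity: [T *m N] and [N *m T] have the same determinant, and both are block
    triangular. *)
Lemma det_1DmulC (A : comNzRingType) m n (U : 'M[A]_(m, n)) (W : 'M[A]_(n, m)) :
  \det (1%:M + U *m W) = \det (1%:M + W *m U).
Proof.
pose N := block_mx 1%:M (- U) W 1%:M.
pose T : 'M[A]_(m + n) := block_mx 1%:M U 0 1%:M.
have T1 : \det T = 1 by rewrite det_ublock !det1 mulr1.
have TN : T *m N = block_mx (1%:M + U *m W) 0 W 1%:M.
  by rewrite mulmx_block !mul1mx !mul0mx !mulmx1 addNr !add0r.
have NT : N *m T = block_mx 1%:M 0 W (1%:M + W *m U).
  by rewrite mulmx_block !mul1mx !mulmx1 !mulmx0 !addr0 subrr [W *m U + _]addrC.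
have := congr1 determinant TN; rewrite det_mulmx mulrC -det_mulmx NT.
by rewrite !det_lblock !det1 mulr1 mul1r.
Qed.

(** * Edge sets mixing two kinds of edges *)

Section SumSets.
Variables (A B : finType).
Implicit Types (F : {set A}) (J : {set B}).

Definition sum_set F J : {set A + B} := (inl @: F) :|: (inr @: J).

Lemma inl_sum_set F J a : (inl a \in sum_set F J) = (a \in F).
Proof.
rewrite inE mem_imset; last by move=> ? ? [].
by case: imsetP => [[] //|]; rewrite orbF.
Qed.

Lemma inr_sum_set F J b : (inr b \in sum_set F J) = (b \in J).
Proof.
rewrite inE orbC mem_imset; last by move=> ? ? [].
by case: imsetP => [[] //|]; rewrite orbF.
Qed.

Lemma big_sum_set (Z : nmodType) (Q : pred {set A + B}) (f : {set A + B} -> Z) :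
  \sum_(S | Q S) f S =
  \sum_(F : {set A}) \sum_(J : {set B} | Q (sum_set F J)) f (sum_set F J).
Proof.
pose k (S : {set A + B}) : {set A} * {set B} := (inl @^-1: S, inr @^-1: S).
rewrite pair_big_dep (reindex_onto (fun p => sum_set p.1 p.2) k) /=; last first.
  by move=> S _; apply/setP => -[a|b]; rewrite ?inl_sum_set ?inr_sum_set inE.
apply: eq_bigl => -[F J] /=; apply/andb_idr => _; rewrite xpair_eqE.
by apply/andP; split; apply/eqP/setP => a;
  rewrite inE ?inl_sum_set ?inr_sum_set.
Qed.

Lemma prod_sum_set (K : comNzRingType) (w : A + B -> K) F J :
  \prod_(e in sum_set F J) w e =
  (\prod_(a in F) w (inl a)) * \prod_(b in J) w (inr b).
Proof.
rewrite big_sumType /=; congr (_ * _); apply: eq_bigl => a.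
  exact: inl_sum_set.
exact: inr_sum_set.
Qed.

Lemma card_sum_set F J : #|sum_set F J| = (#|F| + #|J|)%N.
Proof.
rewrite -!sum1_card big_sumType /=; congr (_ + _)%N; apply: eq_bigl => a.
  exact: inl_sum_set.
exact: inr_sum_set.
Qed.

End SumSets.

(** * Grounded Laplacian, port impedance and the determinant identity *)

Section PortDeterminant.
Variables (R : realType) (V : finType) (E : {set {set V}}) (c : {set V} -> R).
Variables (M : {set V}) (P : {set {set V}}) (r : {set V} -> V).
Variables (q : nat) (x : 'I_q -> V) (L : 'M[R]_q).
Hypothesis (E2 : simple_graph E) (Econn : connected_graph E).
Hypothesis (c_gt0 : forall e, e \in E -> 0 < c e).
Hypothesis (M0 : M != set0) (PM : partition P M).
Hypothesis (rP : forall A, A \in P -> r A \in A).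
Hypothesis (x_inj : injective x).
Hypothesis (xN : [set x i | i : 'I_q] = nonroots M P r).
Hypothesis (LP : is_superport_response E c M P r x L).
Variable r0 : V.

Let n := #|V|.
Let root i := root_of P r (x i).

Definition grounded_laplacian : 'M[R]_n := \matrix_(i, j)
  (laplacian E c (enum_val i) (enum_val j)
   + (enum_val i == r0)%:R * (enum_val j == r0)%:R).

Definition port_incidence : 'M[R]_(q, n) := \matrix_(k, i)
  ((enum_val i == x k)%:R - (enum_val i == root k)%:R).

Definition port_impedance : 'M[R]_q :=
  port_incidence *m invmx grounded_laplacian *m port_incidence^T.

Local Notation Lm := grounded_laplacian.
Local Notation Bm := port_incidence.
Local Notation G := port_impedance.

Lemma laplacian_sym u v : laplacian E c u v = laplacian E c v u.
Proof.
by rewrite /laplacian eq_sym; case: eqP => [->//|_]; rewrite setUC.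
Qed.

Lemma grounded_laplacian_sym : Lm^T = Lm.
Proof.
by apply/matrixP => i j; rewrite !mxE laplacian_sym [X in _ + X]mulrC.
Qed.

Lemma grounded_laplacianM (U : 'cV[R]_n) i :
  (Lm *m U) i 0 = incoming E c (fun v => U (enum_rank v) 0) (enum_val i)
    + (enum_val i == r0)%:R * U (enum_rank r0) 0.
Proof.
rewrite mxE.
have -> : \sum_j Lm i j * U j 0 = \sum_v (laplacian E c (enum_val i) v
      * U (enum_rank v) 0 + (enum_val i == r0)%:R * ((v == r0)%:R * U (enum_rank v) 0)).
  rewrite [RHS](big_enum_val (A := V)) /=; apply: eq_bigr => j _.
  by rewrite !mxE enum_valK mulrDl mulrA.
rewrite big_split /= -mulr_sumr; congr (_ + _ * _).
rewrite (bigD1 r0) //= eqxx mul1r big1 ?addr0 // => v /negPf ->.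
by rewrite mul0r.
Qed.

(** Currents of the network sum to zero, so adding all equations leaves [U r0 = 0]: under balanced
    injection no current flows to ground, and the ungrounded currents are [j]. *)
Lemma grounded_incoming (U j : 'cV[R]_n) : Lm *m U = j -> \sum_i j i 0 = 0 ->
  U (enum_rank r0) 0 = 0 /\
  forall v, incoming E c (fun v => U (enum_rank v) 0) v = j (enum_rank v) 0.
Proof.
move=> LU s0; have Ur : U (enum_rank r0) 0 = 0.
  rewrite -s0 -LU; under [RHS]eq_bigr do rewrite grounded_laplacianM.
  have big_enum_rank (f : V -> R) : \sum_(i < n) f (enum_val i) = \sum_v f v.
    by rewrite (big_enum_val (A := V)).
  rewrite big_split /= big_enum_rank sum_incoming // add0r.
  rewrite (big_enum_rank (fun v => (v == r0)%:R * _)) (bigD1 r0) //= eqxx mul1r.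
  by rewrite big1 ?addr0 // => v /negPf ->; rewrite mul0r.
split=> // v; rewrite -LU grounded_laplacianM Ur mulr0 addr0.
by rewrite enum_rankK.
Qed.

(** A kernel vector carries no current, so its energy is zero and it is constant; it also vanishes
    at [r0]. *)
Lemma grounded_laplacian_unit : Lm \in unitmx.
Proof.
rewrite unitmxE unitfE; apply/det0P => -[v v0 vL].
have LU : Lm *m v^T = 0 by rewrite -grounded_laplacian_sym -trmx_mul vL trmx0.
have [|Ur Ui] := grounded_incoming LU; first by rewrite big1 // => i _; rewrite mxE.
case/eqP: v0; apply/rowP => i; rewrite mxE.
have := energy0 E2 Econn c_gt0 (U := fun v' => v^T (enum_rank v') 0) _ (enum_val i) r0.
rewrite Ur enum_valK mxE => -> //.
by rewrite big1 // => u _; rewrite Ui [X in _ * X]mxE mulr0.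
Qed.

Lemma port_currentE (j : 'cV[R]_q) v :
  (Bm^T *m j) (enum_rank v) 0 = \sum_k ((v == x k)%:R - (v == root k)%:R) * j k 0.
Proof. by rewrite mxE; apply: eq_bigr => k _; rewrite !mxE enum_rankK. Qed.

Lemma port_sum (U : V -> R) k :
  \sum_v ((v == x k)%:R - (v == root k)%:R) * U v = U (x k) - U (root k).
Proof.
have s u : \sum_v (v == u)%:R * U v = U u.
  rewrite (bigD1 u) //= eqxx mul1r big1 ?addr0 // => v /negPf ->.
  by rewrite mul0r.
by under eq_bigr do rewrite mulrBl; rewrite sumrB !s.
Qed.

Lemma x_M k : x k \in M.
Proof.
have : x k \in nonroots M P r by rewrite -xN imset_f.
by rewrite inE => /andP[].
Qed.

Lemma root_neq i k : (x i == root k) = false.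
Proof.
apply/negP => /eqP xi; have : x i \in nonroots M P r by rewrite -xN imset_f.
have [AP _] := pblock_M PM (x_M k).
by rewrite inE xi /root /root_of imset_f.
Qed.

(** Inject [j] at the nonroots and withdraw it at their roots. The resulting potential has port
    voltages [G *m j] and is admissible, so the response sends [G *m j] back to [j]. *)
Lemma mulmx_response_impedance : L *m G = 1%:M.
Proof.
suff h (j : 'cV[R]_q) : L *m (G *m j) = j.
  apply/matrixP => i k; have := h (delta_mx k 0); rewrite mulmxA.
  by move=> /matrixP /(_ i 0); rewrite -colE !mxE eqxx andbT.
pose U : 'cV[R]_n := invmx Lm *m (Bm^T *m j).
have LU : Lm *m U = Bm^T *m j by rewrite mulKVmx // grounded_laplacian_unit.
have [|Ur Ui] := grounded_incoming LU.
  (* The injection is balanced because each port contributes +1 and -1. *)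
  have -> : \sum_i (Bm^T *m j) i 0 = \sum_v (Bm^T *m j) (enum_rank v) 0.
    by rewrite [RHS](big_enum_val (A := V)); apply: eq_bigr => i _; rewrite enum_valK.
  under eq_bigr do rewrite port_currentE.
  rewrite exchange_big /= big1 // => k _; rewrite (port_sum (fun=> j k 0)).
  by rewrite subrr.
apply/esym; apply/LP; exists (fun v => U (enum_rank v) 0); last first.
  move=> i; rewrite Ui port_currentE (bigD1 i) //= eqxx root_neq subr0 mul1r.
  rewrite big1 ?addr0 // => k ki; rewrite (inj_eq x_inj) root_neq subr0.
  by rewrite eq_sym (negPf ki) mul0r.
split.
- move=> i; rewrite -(port_sum (fun v => U (enum_rank v) 0)).
  have -> : G *m j = Bm *m U by rewrite /U /port_impedance !mulmxA.
  rewrite [RHS]mxE (big_enum_val (A := V)) /=; apply: eq_bigr => k _.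
  by rewrite [X in _ = X * _]mxE enum_valK.
- move=> v vM; rewrite Ui port_currentE big1 // => k _.
  have [rM _] := root_of_M PM rP (x_M k).
  case: eqP => [vx|_]; first by rewrite vx x_M in vM.
  case: eqP => [vx|_]; first by rewrite vx rM in vM.
  by rewrite subr0 mul0r.
(* Both ends of a port lie in the same superport, so its contributions to the sum over [A]
   cancel. *)
- move=> A AP; under eq_bigr do rewrite Ui port_currentE.
  rewrite exchange_big /= big1 // => k _.
  rewrite big_mkcond /=.
  transitivity (\sum_v ((v == x k)%:R - (v == root k)%:R)
     * (if v \in A then j k 0 else 0)).
    by apply: eq_bigr => v _; case: ifP => //; rewrite mulr0.
  rewrite port_sum; have [rM rE] := root_of_M PM rP (x_M k).
  have mA v : v \in M -> (v \in A) = (pblock P v == A).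
    move=> vM; have [_ vP] := pblock_M PM vM.
    by apply/idP/eqP => [vA|<- //]; exact: mem_block PM _ _ AP vA.
  by rewrite !mA ?x_M // rE subrr.
Qed.

(** Transposing [L *m G = 1] with [G] symmetric gives [G *m L^T = 1]; hence
    [L = L *m G *m L^T = L^T]. *)
Lemma response_sym : L^T = L.
Proof.
have GT : G^T = G.
  by rewrite /port_impedance !trmx_mul trmxK trmx_inv grounded_laplacian_sym mulmxA.
have GL : G *m L^T = 1%:M.
  by rewrite -[LHS]trmxK trmx_mul trmxK GT mulmx_response_impedance trmx1.
by rewrite -[RHS]mulmx1 -GL mulmxA mulmx_response_impedance mul1mx.
Qed.

Lemma edge_ends : exists ab : {set V} -> V * V, forall e, e \in E ->
  (ab e).1 != (ab e).2 /\ forall u v, link e u v =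
   ((u == (ab e).1) && (v == (ab e).2)) || ((u == (ab e).2) && (v == (ab e).1)).
Proof.
suff h (e : {set V}) : exists p : V * V, e \in E -> p.1 != p.2 /\ forall u v,
    link e u v = ((u == p.1) && (v == p.2)) || ((u == p.2) && (v == p.1)).
  by have [f fP] := choice h; exists f.
case: (boolP (e \in E)) => [eE|]; last by exists (r0, r0).
have [a [b [eab lE]]] := link_ends (E2 eE); exists (a, b) => _; split=> //=.
by apply/eqP => ab; have := E2 eE; rewrite eab ab setUid cards1.
Qed.

(** On the diagonal each incident edge contributes the square of a sign; off it only the edge
    [[set u; v]] contributes, with opposite signs. *)
Lemma laplacian_incidence (ab : {set V} -> V * V) :
  (forall e, e \in E -> (ab e).1 != (ab e).2 /\ forall u v, link e u v =
   ((u == (ab e).1) && (v == (ab e).2)) || ((u == (ab e).2) && (v == (ab e).1))) ->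
  forall u v, laplacian E c u v = \sum_(e in E) c e
     * ((u == (ab e).2)%:R - (u == (ab e).1)%:R)
     * ((v == (ab e).2)%:R - (v == (ab e).1)%:R).
Proof.
move=> abE u v; rewrite /laplacian; case: eqVneq => [<-|uv].
  rewrite big_mkcondr; apply: eq_bigr => e eE; have [ne lE] := abE e eE.
  have -> : (u \in e) = (u == (ab e).1) || (u == (ab e).2).
    suff {1}-> : e = [set (ab e).1; (ab e).2] by rewrite !inE.
    by apply/eqP; rewrite -/(link e (ab e).1 (ab e).2) lE !eqxx.
  have : ~~ ((u == (ab e).1) && (u == (ab e).2)).
    by apply: contra ne => /andP[/eqP <- /eqP <-].
  by case: (u == _); case: (u == _) => //= _; ring.
transitivity (\sum_(e in E) - ((e == [set u; v])%:R * c e)); last first.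
  apply: eq_bigr => e eE; have [ne lE] := abE e eE.
  rewrite -/(link e u v) lE.
  have h1 w : ~~ ((w == (ab e).1) && (w == (ab e).2)).
    by apply: contra ne => /andP[/eqP <- /eqP <-].
  have h2 w : ~~ ((u == w) && (v == w)).
    by apply: contra uv => /andP[/eqP -> /eqP ->].
  move: (h1 u) (h1 v) (h2 (ab e).1) (h2 (ab e).2).
  case: (u == (ab e).1); case: (u == (ab e).2); case: (v == (ab e).1);
    case: (v == (ab e).2) => //= _ _ _ _; ring.
case: ifP => [uvE|uvE].
  rewrite (bigD1 [set u; v]) //= eqxx mul1r big1 ?addr0 // => e /andP[_ /negPf ->].
  by rewrite mul0r oppr0.
rewrite big1 // => e eE; case: eqP => [ee|_]; last by rewrite mul0r oppr0.
by rewrite -ee eE in uvE.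
Qed.

(** The matrix-tree theorem for the augmented graph. The target field is general because the
    identity is used both in the fraction field of the polynomials and in the complex numbers. *)
Lemma port_determinant (K : fieldType) (phi : {rmorphism R -> K}) (z : 'I_q -> K) :
  (forall i, z i != 0) ->
  \sum_(I : {set 'I_q}) phi (Psi E c M P r (x @: I)) * \prod_(i in I) z i =
  \prod_i z i * \det (map_mx phi Lm +
    (map_mx phi Bm)^T *m (diag_mx (\row_i (z i)^-1) *m map_mx phi Bm)).
Proof.
move=> z0; have [ab abE] := edge_ends.
pose a e := match e with inl e => (ab e).1 | inr i => root i end.
pose b e := match e with inl e => (ab e).2 | inr i => x i end.
(* Sets outside [E] get weight 0, so all of [{set V}] can serve as edge labels. *)
pose w e := match e with inl e => if e \in E then phi (c e) else 0
                       | inr i => (z i)^-1 end.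
have adjE (F : {set {set V}}) (J : {set 'I_q}) : F \subset E ->
    adj (fun e u v => ((u == a e) && (v == b e)) ||
    ((u == b e) && (v == a e))) (sum_set F J) =2 augmented_rel P r x F J.
  move=> /subsetP FE u v; apply/exists_inP/orP.
    case=> -[e|i]; rewrite ?inl_sum_set ?inr_sum_set => h uv.
      left; apply/exists_inP; exists e => //.
      by have [_ ->] := abE e (FE e h).
    by right; apply/exists_inP; exists i.
  case=> /exists_inP[e h uv]; [exists (inl e)|exists (inr e)];
    rewrite ?inl_sum_set ?inr_sum_set //=.
  by have [_ <-] := abE e (FE e h).
transitivity (\prod_i z i * \det (\matrix_(i < n, j < n)
   ((enum_val i == r0)%:R * (enum_val j == r0)%:R +
    \sum_e w e * ((enum_val i == b e)%:R - (enum_val i == a e)%:R)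
               * ((enum_val j == b e)%:R - (enum_val j == a e)%:R)))); last first.
  congr (_ * \det _); apply/matrixP => i j; rewrite !mxE big_sumType /=.
  rewrite (laplacian_incidence abE) rmorphD rmorphM !rmorph_nat rmorph_sum.
  rewrite addrA [X in X + _ = _]addrC; congr (_ + _ + _).
    rewrite [RHS]big_mkcond; apply: eq_bigr => e _; case: ifP => _.
      by rewrite !rmorphM !rmorphB !rmorph_nat.
    by rewrite !mul0r.
  apply: eq_bigr => k _; rewrite mul_diag_mx !mxE !rmorphB !rmorph_nat.
  by rewrite mulrCA mulrA.
rewrite matrix_tree big_sum_set mulr_sumr.
under [RHS]eq_bigr do rewrite mulr_sumr.
(* From here [J] is the set of port edges in the tree and the index of [Psi] is its complement. *)
rewrite (exchange_big_dep xpredT) //= (reindex_inj (@setC_inj _)) /=.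
apply: eq_bigr => J _; rewrite Psi_augmented // setCK rmorph_sum mulr_suml.
rewrite big_mkcond [RHS]big_mkcond; apply: eq_bigr => F _.
rewrite prod_sum_set; case: (boolP (F \subset E)) => [FE|/subsetPn[e eF eE]]; last first.
  by rewrite (bigD1 e) //= (negPf eE) !mul0r mulr0; case: ifP.
rewrite card_sum_set /=.
have -> : `[< augmented_tree P r x F J >] = ((#|F| + #|J|).+1 == #|V|) &&
   `[< mg_connected (fun e u v => ((u == a e) && (v == b e)) ||
    ((u == b e) && (v == a e))) setT (sum_set F J) >].
  apply/asboolP/andP => [[/eqP cV conn]|[/eqP cV /asboolP conn]]; split=> //.
    apply/asboolP => u v _ _; rewrite (eq_connect (adjE F J FE)); exact: conn.
  by move=> u v; rewrite -(eq_connect (adjE F J FE)); apply: conn; rewrite inE.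
case: ifP => // _; rewrite /weight rmorph_prod.
rewrite (eq_bigr (fun e => w (inl e))) => [|e eF]; last first.
  by rewrite /= (subsetP FE _ eF).
rewrite mulrCA; congr (_ * _).
(* On [J] the factors [z i] cancel the port conductances, leaving the product over the
   complement. *)
rewrite [X in X * _](bigID (mem J)) /= mulrAC -big_split /=.
rewrite [X in _ = X * _]big1 ?mul1r => [|i _].
  by apply: eq_bigl => i; rewrite inE.
exact: mulfV.
Qed.

(** Factoring out [A] and applying Sylvester's identity gives [\det A * \det (1 + Y G)] with
    [Y = Z^-1]; then [L G = 1] turns [Z (1 + Y G)] into [(1 + Z L) G]. *)
Lemma port_response_determinant (K : fieldType) (phi : {rmorphism R -> K})
    (z : 'I_q -> K) : (forall i, z i != 0) ->
  \sum_(I : {set 'I_q}) phi (Psi E c M P r (x @: I)) * \prod_(i in I) z i =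
  phi (\det Lm * \det G) * \det (1%:M + diag_mx (\row_i z i) *m map_mx phi L).
Proof.
move=> z0; rewrite port_determinant // rmorphM -!det_map_mx.
set A := map_mx phi Lm; set B := map_mx phi Bm; set Z := diag_mx (\row_i z i).
set Y := diag_mx _.
have ZY : Z *m Y = 1%:M.
  apply/matrixP => i j; rewrite mul_diag_mx !mxE.
  by case: eqP => [_|_]; rewrite ?mulr0n ?mulr0 // !mulr1n divff.
have dZ : \det Z = \prod_i z i.
  by rewrite det_diag; apply: eq_bigr => i _; rewrite mxE.
have Au : A \in unitmx by rewrite map_unitmx grounded_laplacian_unit.
have GE : map_mx phi G = B *m invmx A *m B^T.
  by rewrite /port_impedance !map_mxM map_invmx map_trmx.
have LG : map_mx phi L *m map_mx phi G = 1%:M.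
  by rewrite -map_mxM mulmx_response_impedance map_mx1.
have -> : A + B^T *m (Y *m B) = A *m (1%:M + (invmx A *m B^T) *m (Y *m B)).
  by rewrite mulmxDr mulmx1 !mulmxA mulmxV // mul1mx.
have LGZ : Z *m (1%:M + Y *m map_mx phi G)
    = (1%:M + Z *m map_mx phi L) *m map_mx phi G.
  rewrite mulmxDr mulmx1 mulmxA ZY mul1mx mulmxDl mul1mx -mulmxA LG mulmx1.
  by rewrite addrC.
rewrite det_mulmx det_1DmulC -mulmxA [B *m (_ *m _)]mulmxA -GE.
by rewrite mulrCA -dZ -det_mulmx LGZ det_mulmx -mulrA; congr (_ * _); rewrite mulrC.
Qed.

End PortDeterminant.

(** * The port polynomial *)

Lemma det_1D_upper_half_neq0 (R : realType) q (L : 'M[R]_q) (z : 'I_q -> R[i]) :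
  L^T = L -> (forall i, 0 < complex.Im (z i)) ->
  \det (1%:M + diag_mx (\row_i z i) *m map_mx (real_complex R) L) != 0.
Proof.
move=> LT z0; apply/det0P => -[v v0 vN].
pose u i := v 0 i * z i.
have vE j : v 0 j = - \sum_i u i * (L i j)%:C%C.
  move/rowP/(_ j): vN; rewrite mulmxDr mulmx1 mulmxA mxE [X in _ + X]mxE.
  rewrite [RHS]mxE => /eqP; rewrite addr_eq0 => /eqP ->; congr (- _).
  by apply: eq_bigr => i _; rewrite mul_mx_diag !mxE.
pose S := \sum_j conjc (u j) * v 0 j.
have SE : S = - \sum_j \sum_i conjc (u j) * u i * (L i j)%:C%C.
  rewrite -sumrN; apply: eq_bigr => j _; rewrite vE mulrN mulr_sumr.
  by congr (- _); apply: eq_bigr => i _; rewrite mulrA.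
(* Conjugation swaps the two summation indices, and [L] is real and symmetric. *)
have SC : conjc S = S.
  rewrite SE rmorphN rmorph_sum exchange_big /=; congr (- _).
  apply: eq_bigr => j _; rewrite rmorph_sum; apply: eq_bigr => i _.
  have cM (a b : R[i]) : conjc (a * b) = conjc a * conjc b by exact: rmorphM.
  rewrite -[LHS]/(conjc _) (cM (conjc (u j) * u i)) (cM (conjc (u j))).
  rewrite conjcK conjc_real [u j * _]mulrC.
  by rewrite -[in RHS]LT mxE.
(* Each term is the conjugate of [z j] times the squared modulus of [v 0 j]. *)
have ImS : complex.Im S = \sum_j
    - (complex.Im (z j) * (complex.Re (v 0 j) ^+ 2 + complex.Im (v 0 j) ^+ 2)).
  have ImD (I : seq 'I_q) (f : 'I_q -> R[i]) :
      complex.Im (\sum_(j <- I) f j) = \sum_(j <- I) complex.Im (f j).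
    by elim/big_rec2: _ => // j a b _ <-; case: (f j); case: b.
  rewrite ImD; apply: eq_bigr => j _; rewrite /u.
  by case: (v 0 j) (z j) => a b [d e] /=; ring.
have Im0 : complex.Im S = 0.
  have : complex.Im (conjc S) = - complex.Im S by case: (S).
  rewrite SC => /eqP; rewrite -addr_eq0 -mulr2n mulrn_eq0 => /eqP //.
move/eqP: ImS; rewrite Im0 eq_sym sumrN oppr_eq0 psumr_eq0 => [/allP h|j _]; last first.
  by rewrite mulr_ge0 ?addr_ge0 ?sqr_ge0 // ltW.
case/eqP: v0; apply/rowP => j; rewrite mxE; have := h j (mem_index_enum j).
rewrite /= mulf_eq0 gt_eqF //= paddr_eq0 ?sqr_ge0 // !sqrf_eq0.
by case: (v 0 j) => a b /= /andP[/eqP -> /eqP ->].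
Qed.

Section PortPolynomial.
Variables (R : realType) (V : finType) (E : {set {set V}}) (c : {set V} -> R).
Variables (M : {set V}) (P : {set {set V}}) (r : {set V} -> V).
Variables (q : nat) (x : 'I_q -> V).

Local Notation p := (port_polynomial E c M P r x).

Lemma mcoeff_port_polynomial m : p@_m =
  \sum_(I : {set 'I_q}) Psi E c M P r (x @: I)
     * ((\sum_(i in I) U_(i))%MM == m)%:R.
Proof.
rewrite raddf_sum; apply: eq_bigr => I _.
by rewrite /= mcoeffZ (mprodXE R (fun i => U_(i)%MM)) mcoeffX.
Qed.

Lemma port_polynomial_multiaffine : multiaffine p.
Proof.
move=> m; rewrite mcoeff_msupp mcoeff_port_polynomial => pm i.
case: leqP => // mi; case/eqP: pm; rewrite big1 // => I _.
case: eqP => [Im|_]; last by rewrite mulr0.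
move: mi; rewrite -Im mnm_sumE; under eq_bigr do rewrite mnm1E.
case: (boolP (i \in I)) => iI; last first.
  by rewrite big1 // => k kI; rewrite (negPf (memPn iI _ kI)).
rewrite (bigD1 i) //= eqxx big1 // => k /andP[_ /negPf ->] //.
Qed.

Lemma Psi_ge0 (I : {set V}) : (forall e, e \in E -> 0 < c e) ->
  0 <= Psi E c M P r I.
Proof.
move=> c0; have w0 (F : {set {set V}}) : spanning_forest E F -> 0 <= weight c F.
  by case=> /subsetP FE _; apply: prodr_ge0 => e /FE /c0 /ltW.
rewrite /Psi; case: ifP => _; apply: sumr_ge0 => F /asboolP; [case|case] => h *;
  exact: w0.
Qed.

Lemma port_polynomial_coef_nonneg : (forall e, e \in E -> 0 < c e) ->
  coef_nonneg p.
Proof.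
move=> c0 m; rewrite mcoeff_port_polynomial; apply: sumr_ge0 => I _.
by rewrite mulr_ge0 ?Psi_ge0 ?ler0n.
Qed.

(** An arbitrary ring morphism covers the embedding into fractions, evaluation at 0 and evaluation
    at a complex point. *)
Lemma map_port_polynomial (K : comNzRingType) (f : {rmorphism {mpoly R[q]} -> K}) :
  f p = \sum_(I : {set 'I_q}) f (Psi E c M P r (x @: I))%:MP
    * \prod_(i in I) f 'X_i.
Proof.
rewrite rmorph_sum; apply: eq_bigr => I _.
by rewrite -mul_mpolyC rmorphM rmorph_prod.
Qed.

End PortPolynomial.

Theorem theorem5p4 (R : realType) (V : finType)
    (E : {set {set V}}) (c : {set V} -> R)
    (M : {set V}) (P : {set {set V}}) (r : {set V} -> V)
    (q : nat) (x : 'I_q -> V) (L : 'M[R]_q) :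
  simple_graph E -> connected_graph E ->
  (forall e, e \in E -> 0 < c e) ->
  M != set0 -> partition P M ->
  (forall A, A \in P -> r A \in A) ->
  injective x -> [set x i | i : 'I_q] = nonroots M P r ->
  is_superport_response E c M P r x L ->
  let p : {mpoly R[q]} := port_polynomial E c M P r x in
  let X : 'M[{mpoly R[q]}]_q := diag_mx (\row_i 'X_i) in
  [/\ p = Phi_valid E c M P *: \det (1%:M + X *m map_mx (@mpolyC q R) L),
      multiaffine p,
      coef_nonneg p
    & real_stable p].
Proof.
move=> E2 Econn c0 M0 PM rP xi xN LP p X.
have /set0Pn[r0 _] := M0.
set A := grounded_laplacian E c r0; set G := port_impedance E c P r x r0.
have Au : A \in unitmx by exact: grounded_laplacian_unit.
have LG : L *m G = 1%:M by exact: (mulmx_response_impedance E2 Econn c0 PM rP xi xN).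
have D0 : \det A * \det G != 0.
  rewrite mulf_eq0 negb_or -unitfE -unitmxE Au /=.
  by have := oner_neq0 R; rewrite -(det1 R q) -LG det_mulmx mulf_eq0 negb_or => /andP[].
have det := port_response_determinant E2 Econn c0 M0 PM rP xi xN LP r0.
have pE : p = (\det A * \det G) *: \det (1%:M + X *m map_mx (@mpolyC q R) L).
  (* The determinant identity inverts each variable, so it is applied to the indeterminates in the
     fraction field and pulled back by injectivity. *)
  pose F : {rmorphism {mpoly R[q]} -> {fraction {mpoly R[q]}}} := @FracField.tofrac _.
  apply/eqP; rewrite -tofrac_eq -/(F _) -/(F _) map_port_polynomial.
  have X0 i : F 'X_i != 0.
    rewrite tofrac_eq0; apply/eqP => /(congr1 (mcoeff U_(i)%MM)).
    by rewrite mcoeffXU eqxx mcoeff0 => /eqP; rewrite oner_eq0.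
  have := det _ (F \o mpolyC q (R := R)) _ X0 => /= ->.
  apply/eqP; rewrite -mul_mpolyC [RHS]rmorphM -[F (\det _)]det_map_mx; congr (_ * \det _).
  rewrite map_mxD map_mx1 map_mxM map_mx_comp; congr (_ + _ *m _).
  by rewrite map_diag_mx; congr diag_mx; apply/rowP => i; rewrite !mxE.
(* At the origin only the empty index set survives on the left, and the determinant becomes 1 on the
   right. *)
have Phi : Phi_valid E c M P = \det A * \det G.
  have := congr1 (meval (fun=> 0)) pE.
  rewrite map_port_polynomial (bigD1 set0) //=.
  rewrite [X in _ + X = _]big1 ?addr0 => [|I /set0Pn[i iI]].
    rewrite imset0 big_set0 mulr1 mevalC /Psi eqxx => ->.
    rewrite mevalZ -det_map_mx map_mxD map_mx1 map_mxM.
    rewrite (_ : map_mx _ X = 0) ?mul0mx ?addr0 ?det1 ?mulr1 //.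
    by apply/matrixP => i j; rewrite !mxE rmorphMn /= mevalXU mul0rn.
  by rewrite (bigD1 i) //= mevalXU mul0r mulr0.
split.
- by rewrite Phi.
- exact: port_polynomial_multiaffine.
- exact: port_polynomial_coef_nonneg.
- move=> z z0; pose F : {rmorphism {mpoly R[q]} -> R[i]} :=
    meval z \o map_mpoly (real_complex R).
  have z1 i : z i != 0 by apply: contraTneq (z0 i) => ->; rewrite ltxx.
  have -> : (map_mpoly (real_complex R) p).@[z] =
      \sum_(I : {set 'I_q}) (Psi E c M P r (x @: I))%:C%C * \prod_(i in I) z i.
    rewrite [LHS](map_port_polynomial E c M P r x F); apply: eq_bigr => I _.
    congr (_ * _); first by rewrite /F /= map_mpolyC mevalC.
    by apply: eq_bigr => i _; rewrite /F /= map_mpolyX mevalXU.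
  rewrite (det _ (real_complex R) _ z1) mulf_eq0 negb_or fmorph_eq0 D0 /=.
  apply: det_1D_upper_half_neq0 => //.
  exact: (response_sym E2 Econn c0 PM rP xi xN LP r0).
Qed.
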